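(* Let $p\ge2$ and let $f,h:\mathbb{R}^n\to(-\infty,\infty]$ be proper, closed, prox-bounded and prox-regular. Let $x^*\in\mathbb{R}^n$ and $w\in\mathbb{R}^n$ satisfy $-w\in\partial f(x^* )$ and $w\in\partial h(x^* )$, and for $t>0$ set $z^*=x^*+tw$ and $F_{\mathrm{DRS}}(z)=\mathrm{prox}_{th}(z)-\mathrm{prox}_{tf}(2\,\mathrm{prox}_{th}(z)-z)$. Consider the conditions: (B1$'$) $-w\in\mathrm{ri}\,\partial f(x^* )$ and $w\in\mathrm{ri}\,\partial h(x^* )$ (strict complementarity), $f$ is $C^p$-partly smooth at $x^*$ for $-w$ relative to some $C^p$ embedded submanifold $\mathcal{M}^f_{x^*}\ni x^*$, and $h$ is $C^p$-partly smooth at $x^*$ for $w$ relative to some $C^p$ embedded submanifold $\mathcal{M}^h_{x^*}\ni x^*$; (B2$'$) (for the given $t$) $f$ is twice epi-differentiable at $x^*$ for $-w$ and $h$ is twice epi-differentiable at $x^*$ for $w$, both with generalized quadratic second subderivatives; the sets of points where $\mathrm{prox}_{tf}$, respectively $\mathrm{prox}_{th}$, is not differentiable are closed; and $\mathrm{prox}_{tf}$ and $\mathrm{prox}_{th}$ are $C^{p-1}$ on the complements of these sets. Then for all sufficiently small $t>0$: if (B1$'$) holds, or (B2$'$) holds for this $t$, then $F_{\mathrm{DRS}}$ is $C^{p-1}$ on a neighborhood of $z^*$.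
   Context: $\mathrm{prox}_{t\phi}(y)=\arg\min_x\{\phi(x)+\frac1{2t}\|x-y\|^2\}$; prox-bounded: this infimum is $>-\infty$ for some $t>0,y$. Regular subgradients $\hat\partial\phi(x)$: $v$ with $\phi(y)\ge\phi(x)+\langle v,y-x\rangle+o(\|y-x\|)$; limiting subgradients $\partial\phi(x)$: limits of $v_k\in\hat\partial\phi(x_k)$, $x_k\to x$, $\phi(x_k)\to\phi(x)$ (for prox-regular functions these coincide). Prox-regularity at $\bar x$ for $\bar v$ (constants $\varepsilon,\rho$): $\phi(y)\ge\phi(x)+\langle v,y-x\rangle-\frac\rho2\|y-x\|^2$ for $y\in B(\bar x,\varepsilon)$ whenever $v\in\partial\phi(x)$, $\|v-\bar v\|<\varepsilon$, $\|x-\bar x\|<\varepsilon$, $\phi(x)<\phi(\bar x)+\varepsilon$. $\mathrm{ri}$ is relative interior. $C^p$-partial smoothness of $\phi$ at $x$ for $v$ relative to $\mathcal{M}$: (i) $\phi|_{\mathcal{M}}$ is $C^p$ near $x$; (ii) $\phi$ is prox-regular at $x$ for $v$; (iii) $\mathrm{par}\,\hat\partial\phi(x)=N_{\mathcal{M}}(x)$ (subspace parallel to the affine hull equals normal space); (iv) for some neighborhood $V$ of $v$, $x'\mapsto V\cap\partial\phi(x')$ is inner semicontinuous at $x$ relative to $\mathcal{M}$. Second subderivative: $\Delta^2_\tau\phi(x|v)[u]=\frac{\phi(x+\tau u)-\phi(x)-\tau\langle v,u\rangle}{\tau^2/2}$, $\mathrm{d}^2\phi(x|v)[u]=\liminf_{\tau\downarrow0,u'\to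 u}\Delta^2_\tau\phi(x|v)[u']$; twice epi-differentiable means epi-convergence of $\Delta^2_\tau\phi(x|v)$ to $\mathrm{d}^2\phi(x|v)$; generalized quadratic means $\mathrm{d}^2\phi(x|v)[u]=\langle u,Mu\rangle+\delta_S(u)$ for a matrix $M$ and linear subspace $S$. *)

(* Defs.v *)
From HB Require Import structures.
From mathcomp Require Import all_boot all_order all_algebra.
From mathcomp Require Import all_classical all_reals all_analysis.
Set Implicit Arguments. Unset Strict Implicit. Unset Printing Implicit Defensive.
Import Order.TTheory GRing.Theory Num.Theory.
Import numFieldNormedType.Exports.
Local Open Scope classical_set_scope.
Local Open Scope ring_scope.

Definition inner {R : realType} {n : nat} (x y : 'rV[R]_n) : R := (x *m y^T) 0 0.
Definition enorm {R : realType} {n : nat} (x : 'rV[R]_n) : R := Num.sqrt (inner x x).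

Fixpoint Ck {R : realType} {V W : normedModType R} (k : nat) (f : V -> W)
  (U : set V) : Prop :=
  match k with
  | 0 => forall x, U x -> {for x, continuous f}
  | k'.+1 => (forall x, U x -> differentiable f x) /\
             (forall v : V, Ck k' (fun x => 'D_v f x) U)
  end.

Definition Ck_near {R : realType} {V W : normedModType R} (k : nat) (f : V -> W)
  (x : V) : Prop := exists U : set V, [/\ open U, U x & Ck k f U].

Section Variational.
Context {R : realType} {n : nat}.
Local Notation E := 'rV[R]_n.
Implicit Types (phi : E -> \bar R) (x y u v : E) (t : R).

Definition proper_fun phi : Prop :=
  (forall x, phi x != -oo%E) /\ (exists x, phi x \is a fin_num).

Definition closed_fun phi : Prop := lower_semicontinuous phi.

Definition qpen t y x : R := (2 * t)^-1 * inner (x - y) (x - y).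

Definition prox_bounded phi : Prop :=
  exists t, exists y, 0 < t /\
    (-oo < ereal_inf [set (phi x + (qpen t y x)%:E)%E | x in [set: E]])%E.

Definition prox t phi y : set E :=
  [set x | forall x', (phi x + (qpen t y x)%:E <= phi x' + (qpen t y x')%:E)%E].

Definition rsubdiff phi x : set E :=
  [set v | phi x \is a fin_num /\
     forall eps : R, 0 < eps -> exists2 delta : R, 0 < delta &
       forall y, enorm (y - x) < delta ->
         (phi x + (inner v (y - x) - eps * enorm (y - x))%:E <= phi y)%E].

Definition lsubdiff phi x : set E :=
  [set v | phi x \is a fin_num /\
     exists (xk vk : nat -> E),
       [/\ xk @ \oo --> x, (phi \o xk) @ \oo --> phi x, vk @ \oo --> v &
           forall k, rsubdiff phi (xk k) (vk k)]].

Definition prox_regular_at phi xb vb : Prop :=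
  lsubdiff phi xb vb /\
  exists eps : R, exists rho : R, [/\ 0 < eps, 0 <= rho &
    forall x v, lsubdiff phi x v -> enorm (v - vb) < eps ->
      enorm (x - xb) < eps -> (phi x < phi xb + eps%:E)%E ->
      forall y, enorm (y - xb) < eps ->
        (phi x + (inner v (y - x) - rho / 2 * inner (y - x) (y - x))%:E
           <= phi y)%E].

Definition prox_regular phi : Prop :=
  forall x v, lsubdiff phi x v -> prox_regular_at phi x v.

Definition aff_hull (C : set E) : set E :=
  [set z | exists k : nat, exists (a : 'I_k -> R) (c : 'I_k -> E),
     [/\ \sum_(i < k) a i = 1, forall i, C (c i) & z = \sum_(i < k) a i *: c i]].

Definition ri (C : set E) : set E :=
  [set x | C x /\ exists2 eps : R, 0 < eps &
     forall y, aff_hull C y -> enorm (y - x) < eps -> C y].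

Definition par_aff (C : set E) : set E :=
  [set z | exists a b, [/\ aff_hull C a, aff_hull C b & z = a - b]].

Definition Cp_submanifold (p : nat) (M : set E) : Prop :=
  forall x, M x -> exists m : nat, exists U : set E, exists Phi : E -> 'rV[R]_m,
    [/\ open U, U x, Ck p Phi U,
        (forall w : 'rV[R]_m, exists v : E, 'D_v Phi x = w) &
        forall y, U y -> (M y <-> Phi y = 0)].

Definition tangent_cone (M : set E) x : set E :=
  [set u | exists (xk : nat -> E) (tk : nat -> R),
     [/\ forall k, M (xk k), forall k, 0 < tk k, xk @ \oo --> x,
         tk @ \oo --> 0 & (fun k => (tk k)^-1 *: (xk k - x)) @ \oo --> u]].

Definition normal_space (M : set E) x : set E :=
  [set v | forall u, tangent_cone M x u -> inner v u = 0].

Definition restr_Cp_near (p : nat) phi (M : set E) x : Prop :=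
  exists U : set E, exists g : E -> R,
    [/\ open U, U x, Ck p g U & forall y, U y -> M y -> phi y = (g y)%:E].

Definition isc_rel (S : E -> set E) (X : set E) x : Prop :=
  forall v, S x v -> forall eps : R, 0 < eps -> exists2 delta : R, 0 < delta &
    forall x', X x' -> enorm (x' - x) < delta ->
      exists v', S x' v' /\ enorm (v' - v) < eps.

Definition partly_smooth (p : nat) phi x v (M : set E) : Prop :=
  [/\ M x,
      restr_Cp_near p phi M x,
      prox_regular_at phi x v,
      par_aff (rsubdiff phi x) = normal_space M x &
      exists V : set E, [/\ open V, V v &
        isc_rel (fun x' => V `&` lsubdiff phi x') M x]].

Definition sdq phi x v (tau : R) u : \bar R :=
  ((phi (x + tau *: u)%R - phi x - (tau * inner v u)%:E) * ((tau ^+ 2 / 2)^-1)%:E)%E.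

Definition subderiv2 phi x v u : \bar R :=
  ereal_sup [set ereal_inf [set r | exists (u' : E) (tau : R),
                   [/\ enorm (u' - u) < d, 0 < tau < d & r = sdq phi x v tau u']]
             | d in [set d : R | 0 < d]].

(* twice epi-differentiable: sdq phi x v tau epi-converges to d^2 phi(x|v)
   as tau \downarrow 0 (sequential characterization of epi-convergence) *)
Definition twice_epi_diff phi x v : Prop :=
  phi x \is a fin_num /\
  forall tk : nat -> R, (forall k, 0 < tk k) -> tk @ \oo --> 0 ->
    forall u,
      (forall uk : nat -> E, uk @ \oo --> u ->
         (subderiv2 phi x v u <= limn_einf (fun k => sdq phi x v (tk k) (uk k)))%E) /\
      (exists2 uk : nat -> E, uk @ \oo --> u &
         (limn_esup (fun k => sdq phi x v (tk k) (uk k)) <= subderiv2 phi x v u)%E).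

Definition lin_subspace (S : set E) : Prop :=
  S 0 /\ forall (a b : R) y z, S y -> S z -> S (a *: y + b *: z).

Definition gen_quadratic_subderiv2 phi x v : Prop :=
  exists (Mq : 'M[R]_n) (S : set E), lin_subspace S /\
    forall u, subderiv2 phi x v u =
      (if `[< S u >] then (inner u (u *m Mq^T))%:E else +oo)%E.

Definition setmap_diff_at (P : E -> set E) y : Prop :=
  exists U : set E, exists g : E -> E,
    [/\ open U, U y, forall z, U z -> P z = [set g z] & differentiable g y].

Definition setmap_Ck_on (k : nat) (P : E -> set E) (O : set E) : Prop :=
  exists g : E -> E, (forall z, O z -> P z = [set g z]) /\ Ck k g O.

Definition F_DRS t phi psi z : set E :=
  [set d | exists a b, [/\ prox t psi z a, prox t phi (2 *: a - z) b & d = a - b]].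

Definition condB1 (p : nat) phi psi xs w : Prop :=
  [/\ ri (lsubdiff phi xs) (- w), ri (lsubdiff psi xs) w,
      (exists Mf : set E, [/\ Cp_submanifold p Mf, Mf xs & partly_smooth p phi xs (- w) Mf]) &
      (exists Mh : set E, [/\ Cp_submanifold p Mh, Mh xs & partly_smooth p psi xs w Mh])].

Definition condB2 (p : nat) t phi psi xs w : Prop :=
  [/\ twice_epi_diff phi xs (- w) /\ gen_quadratic_subderiv2 phi xs (- w),
      twice_epi_diff psi xs w /\ gen_quadratic_subderiv2 psi xs w,
      closed [set y | ~ setmap_diff_at (prox t phi) y] /\
        setmap_Ck_on p.-1 (prox t phi) [set y | setmap_diff_at (prox t phi) y] &
      closed [set y | ~ setmap_diff_at (prox t psi) y] /\
        setmap_Ck_on p.-1 (prox t psi) [set y | setmap_diff_at (prox t psi) y]].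

End Variational.

(* Main.v *)
(* Proof idea. With [v] a subgradient of [phi] at [xs] and [t] small,
   prox-boundedness and prox-regularity make [phi + |. - y|^2 / 2t] grow
   quadratically around [xs] for [y = xs + t v], so the proximal map is
   single-valued near [y], with [|prox y' - xs| <= C |y' - y|].

   Under (B1'), proximal points near [xs] lie on the active manifold
   (identification). In a chart of the manifold the proximal point is a critical
   point of a smooth function whose Hessian is positive definite by quadratic
   growth, and the inverse function theorem gives the smoothness.

   Under (B2'), difference quotients of the proximal map at [y] minimise
   second-order difference quotients of [phi] plus a quadratic. Epi-convergence
   identifies their limits with the unique minimiser of a quadratic over a
   subspace, which depends linearly on the direction. Hence the proximal map is
   differentiable at [y], so [y] lies in the open set where it is smooth.

   The operator is then a composition of the two proximal maps, which send
   [xs + t w] to [xs] and [2 xs - (xs + t w) = xs - t w] to [xs]. *)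

Require Import Defs.
From HB Require Import structures.
From mathcomp Require Import all_boot all_order all_algebra.
From mathcomp Require Import all_classical all_reals all_analysis.
From mathcomp Require Import ring lra.
Import Order.TTheory GRing.Theory Num.Theory.
Import numFieldNormedType.Exports.
Local Open Scope classical_set_scope.
Local Open Scope ring_scope.

(** * Calculus of C^k maps *)

(** Everything rests on one margin, [t^-1 - r > 0]: the curvature of the penalty exceeds the worst
    negative curvature of [phi], where [r] is large enough both for prox-regularity near [xs] and
    for the global minorant that prox-boundedness gives far away. It yields existence, the distance
    estimate, uniqueness, and the positive definiteness used under either condition; the threshold
    [1 / r] is fixed before the choice between the conditions. The obstacle is that prox-regularity
    speaks only of subgradients localised in point, subgradient and function value, so proximal
    points must be shown to satisfy all three, although [phi] need not be continuous. Under (B1')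
    the chart ignores normal directions; a quadratic penalty on them restores a nondegenerate
    Hessian. Criticality is solved by inverting [(u, y) |-> (gradient in u, y)], and passing to the
    gradient costs the one derivative between [C^p] and [C^(p-1)]. Under (B2') the limit equation is
    not solved by linear algebra: its solutions arise as limits of difference quotients, and only
    their uniqueness is computed. *)

Section Differentials.
Set Implicit Arguments. Unset Strict Implicit.
Context {R : realType}.
Implicit Types V W : normedModType R.

(** Replaces little-o notation by an explicit estimate with a candidate differential; the inverse
    map and the proximal map are differentiated through it. *)
Lemma is_diff_eps V W (f : V -> W) x (L : {linear V -> W}) :
  continuous L ->
  (forall e : R, 0 < e ->
     \forall h \near (0 : V), `|f (x + h) - f x - L h| <= e * `|h|) ->
  is_diff x f L.
Proof.
move=> cL hL.
have E : f \o shift x = cst (f x) + L +o_ 0 id.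
  apply/eqaddoP => e e0; have := hL _ e0; apply: filterS => h.
  by rewrite !fctE /= (addrC h) opprD addrA.
have dE := diff_unique cL E.
by apply: DiffDef; rewrite ?dE //; apply/diff_locallyP; rewrite dE.
Qed.

Lemma diff_eps V W (f : V -> W) x : differentiable f x ->
  forall e : R, 0 < e ->
    \forall h \near (0 : V), `|f (x + h) - f x - 'd f x h| <= e * `|h|.
Proof.
move=> /diff_locally /eqaddoP df e e0; have := df _ e0.
by apply: filterS => h; rewrite !fctE /= (addrC h) opprD addrA.
Qed.

Lemma near_eq_differentiable V W (f g : V -> W) x :
  {near x, f =1 g} -> differentiable f x -> differentiable g x.
Proof.
move=> fg df; suff : is_diff x g ('d f x) by case.
apply: is_diff_eps; first exact: diff_continuous.
move=> e e0; have gx := nbhs_singleton fg.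
move: (fg); rewrite (near_shift 0 x) => fg'.
near=> h.
have <- : f (x + h) = g (x + h).
  have : f ((shift (x - 0)) h) = g ((shift (x - 0)) h) by near: h; exact: fg'.
  by rewrite /= subr0 addrC.
by rewrite -gx; near: h; exact: diff_eps.
Unshelve. all: by end_near. Qed.

(** Openness turns equality on [U] into equality near each point, which is all that derivatives see.
    The rules below compute a derivative on [U] and transfer the regularity of the formula through
    this lemma. *)
Lemma Ck_ext V W k (f g : V -> W) (U : set V) : open U ->
  (forall x, U x -> f x = g x) -> Ck k f U -> Ck k g U.
Proof.
elim: k f g => [|k IH] f g oU fg /=.
  move=> cf x Ux; have nU : nbhs x U by exact: open_nbhs_nbhs.
  rewrite /prop_for /continuous_at -fg //.
  apply: cvg_trans (cf x Ux); apply: near_eq_cvg.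
  by near=> y; apply: fg; near: y.
move=> [df Df]; split=> [x Ux|v].
  apply: (@near_eq_differentiable _ _ f) (df x Ux).
  by near=> y; apply: fg; near: y; exact: open_nbhs_nbhs.
apply: IH (Df v) => // x Ux; apply: near_eq_derive.
by near=> y; apply: fg; near: y; exact: open_nbhs_nbhs.
Unshelve. all: by end_near. Qed.

Lemma Ck_sub V W k (f : V -> W) (A B : set V) : A `<=` B -> Ck k f B -> Ck k f A.
Proof.
move=> AB; elim: k f => [|k IH] f /= => [cf x /AB|[df Df]]; first exact: cf.
by split=> [x /AB|v]; [exact: df|exact: IH].
Qed.

Lemma Ck_pred V W k (f : V -> W) (U : set V) : Ck k.+1 f U -> Ck k f U.
Proof.
elim: k f => [|k IH] f; first by move=> [df _] x Ux; exact: differentiable_continuous (df x Ux).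
by move=> [df Df]; split=> [//|v]; exact: IH (Df v).
Qed.

Lemma Ck_le V W j k (f : V -> W) (U : set V) : (j <= k)%N -> Ck k f U -> Ck j f U.
Proof.
move=> /subnK <-; elim: (k - j)%N => [//|i IH].
by rewrite addSn => /Ck_pred/IH.
Qed.

Lemma Ck_continuous V W k (f : V -> W) (U : set V) x :
  Ck k f U -> U x -> {for x, continuous f}.
Proof. by move=> /(Ck_le (leq0n k)); exact. Qed.

Lemma Ck_diff V W k (f : V -> W) (U : set V) x :
  (0 < k)%N -> Ck k f U -> U x -> differentiable f x.
Proof. by case: k => // k _ [df _]; exact: df. Qed.

Lemma Ck_cst V W k (c : W) (U : set V) : Ck k (fun=> c) U.
Proof.
elim: k c => [|k IH] c /=; first by move=> x _; exact: cst_continuous.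
split=> [x _|v]; first exact: differentiable_cst.
rewrite (_ : 'D_v (fun=> c) = (fun=> 0) :> (V -> W)); first exact: IH.
by apply/funext => x; exact: derive_cst.
Qed.

Lemma derive_lin V W (L : {linear V -> W}) v x : continuous L -> 'D_v L x = L v.
Proof.
by move=> cL; rewrite deriveE ?diff_lin //; exact: linear_differentiable.
Qed.

Lemma Ck_lin V W k (L : {linear V -> W}) (U : set V) : continuous L -> Ck k L U.
Proof.
move=> cL; case: k => [x _|k /=]; first exact: cL.
split=> [x _|v]; first exact: linear_differentiable.
rewrite (_ : 'D_v L = (fun=> L v) :> (V -> W)); first exact: Ck_cst.
by apply/funext => x; exact: derive_lin.
Qed.

Lemma Ck_id V k (U : set V) : Ck k (@id V) U.
Proof. by apply: (@Ck_lin _ _ _ (@idfun V)) => x; exact: cvg_id. Qed.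

Lemma Ck_add V W k (f g : V -> W) (U : set V) : open U ->
  Ck k f U -> Ck k g U -> Ck k (fun x => f x + g x) U.
Proof.
move=> oU; elim: k f g => [|k IH] f g.
  by move=> cf cg x Ux; apply: continuousD; [exact: cf|exact: cg].
move=> [df Df] [dg Dg]; split=> [x Ux|v].
  by apply: differentiableD; [exact: df|exact: dg].
apply: (Ck_ext oU _ (IH _ _ (Df v) (Dg v))) => x Ux /=.
by rewrite -deriveD //; apply: diff_derivable; [exact: df|exact: dg].
Qed.

Lemma Ck_lincomp V W W' k (L : {linear W -> W'}) (f : V -> W) (U : set V) :
  open U -> continuous L -> Ck k f U -> Ck k (fun x => L (f x)) U.
Proof.
move=> oU cL; elim: k f => [|k IH] f.
  move=> cf x Ux; apply: continuous_comp; [exact: cf|exact: cL].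
move=> [df Df]; split=> [x Ux|v].
  by apply: differentiable_comp; [exact: df|exact: linear_differentiable].
apply: (Ck_ext oU _ (IH _ (Df v))) => x Ux /=.
have dL : differentiable L (f x) by exact: linear_differentiable.
rewrite [RHS]deriveE; last by apply: differentiable_comp => //; exact: df.
rewrite (@diff_comp _ _ _ _ f L) //; last exact: df.
by rewrite /= (diff_lin _ cL) deriveE //; exact: df.
Qed.

Lemma Ck_opp V W k (f : V -> W) (U : set V) : open U ->
  Ck k f U -> Ck k (fun x => - f x) U.
Proof.
by move=> oU; apply: (@Ck_lincomp _ _ _ _ (@GRing.opp W)) => // x; exact: opp_continuous.
Qed.

Lemma Ck_sum V W k (I : Type) (r : seq I) (F : I -> V -> W) (U : set V) : open U ->
  (forall i, Ck k (F i) U) -> Ck k (fun x => \sum_(i <- r) F i x) U.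
Proof.
move=> oU cF; elim: r => [|i r IH].
  by under eq_fun do rewrite big_nil; exact: Ck_cst.
by under eq_fun do rewrite big_cons; exact: Ck_add.
Qed.

(** Scaling is packed as a continuous bilinear map so that the product rule becomes the chain rule
    for a bilinear map after a pair. *)
Lemma is_diff_scale V W (a : V -> R) (f : V -> W) x :
  differentiable a x -> differentiable f x ->
  is_diff x (fun y => a y *: f y) (fun h => a x *: 'd f x h + 'd a x h *: f x).
Proof.
move=> da df.
have bil : bilinear_for
    (GRing.Scale.Law.clone _ _ *:%R _) (GRing.Scale.Law.clone _ _ *:%R _)
    (@GRing.scale R W).
  split=> [u c u1 u2|u c u1 u2] /=; first by rewrite scalerDl scalerA.
  by rewrite scalerDr !scalerA mulrC.
pose bM := bilinear_isBilinear.Build R R W W _ _ (@GRing.scale R W) bil.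
pose B : {bilinear R -> W -> W} := HB.pack (@GRing.scale R W) bM.
have cB : continuous (fun p : R * W => B p.1 p.2).
  move=> p; apply: (@continuousZ _ _ _ (fun q : R * W => q.1) (fun q => q.2));
  [exact: cvg_fst|exact: cvg_snd].
have dB p := differentiable_bilin p cB.
have := @is_diff_comp _ _ _ _ (fun y => (a y, f y)) (fun h => ('d a x h, 'd f x h))
  (fun p => B p.1 p.2) (fun q => B (a x) q.2 + B q.1 (f x)) x.
apply.
  by apply: is_diff_pair; exact: differentiableP.
by apply: DiffDef => //; exact: diff_bilin.
Qed.

Lemma Ck_scale V W k (a : V -> R) (f : V -> W) (U : set V) : open U ->
  Ck k a U -> Ck k f U -> Ck k (fun x => a x *: f x) U.
Proof.
move=> oU; elim: k a f => [|k IH] a f.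
  by move=> ca cf x Ux; apply: continuousZ; [exact: ca|exact: cf].
move=> Ca Cf; have [da Da] := Ca; have [df Df] := Cf; split=> [x Ux|v].
  by have [] := is_diff_scale (da x Ux) (df x Ux).
have C : Ck k (fun x => a x *: 'D_v f x + 'D_v a x *: f x) U.
  by apply: Ck_add => //; apply: IH; [exact: Ck_pred Ca|exact: Df|exact: Da|exact: Ck_pred Cf].
apply: Ck_ext oU _ C => x Ux /=.
have ds := is_diff_scale (da x Ux) (df x Ux).
rewrite [RHS]deriveE; last by case: ds.
by rewrite diff_val !deriveE //; [exact: da|exact: df].
Qed.

(** The derivative [- a^-2 * 'D_v a] contains [a^-1] itself, but only at the order already supplied
    by the induction. *)
Lemma Ck_inv V k (a : V -> R) (U : set V) : open U ->
  (forall x, U x -> a x != 0) -> Ck k a U -> Ck k (fun x => (a x)^-1) U.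
Proof.
move=> oU; elim: k a => [|k IH] a a0.
  by move=> ca x Ux; apply: continuousV; [exact: a0|exact: ca].
move=> Ca; have [da Df] := Ca; split=> [x Ux|v].
  by apply: differentiableV; [exact: da|exact: a0].
have Ci := IH a a0 (Ck_pred Ca).
have C2 : Ck k (fun x => (a x)^-1 *: (a x)^-1) U by exact: Ck_scale.
have C : Ck k (fun x => (- ((a x)^-1 *: (a x)^-1)) *: 'D_v a x) U.
  by apply: Ck_scale (Df v) => //; exact: (Ck_opp oU C2).
apply: Ck_ext oU _ C => x Ux /=.
rewrite [RHS]deriveE; last by apply: differentiableV; [exact: da|exact: a0].
rewrite diffV; [|exact: da|exact: a0].
rewrite deriveE; last exact: da.
by rewrite /= /GRing.scale /= expr2 invfM.
Qed.

End Differentials.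

(** * Coordinates, matrix-valued maps and mean value estimates *)

Section Matrices.
Set Implicit Arguments. Unset Strict Implicit.
Context {R : realType}.
Implicit Types V W : normedModType R.

Lemma coord_linear m n (i : 'I_m) (j : 'I_n) :
  linear (fun A : 'M[R]_(m, n) => A i j : R).
Proof. by move=> a A B; rewrite !mxE. Qed.

Definition coordL m n (i : 'I_m) (j : 'I_n) : {linear 'M[R]_(m, n) -> R} :=
  HB.pack (fun A : 'M[R]_(m, n) => A i j : R)
    (GRing.isLinear.Build _ _ _ _ _ (@coord_linear m n i j)).

Lemma coord_norm m n (A : 'M[R]_(m, n)) i j : `|A i j| <= `|A|.
Proof.
by rewrite [leRHS]/Num.Def.normr/= mx_normrE; exact: (le_bigmax _ _ (i, j)).
Qed.

Lemma norm_coord m n (A : 'M[R]_(m, n)) (c : R) : 0 <= c ->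
  (forall i j, `|A i j| <= c) -> `|A| <= c.
Proof.
move=> c0 Ac; rewrite [leLHS]/Num.Def.normr/= mx_normrE.
by apply: bigmax_le => // -[i j] _; exact: Ac.
Qed.

Lemma linear_rV_continuous m W (L : {linear 'rV[R]_m -> W}) : continuous L.
Proof.
move=> x.
rewrite (_ : (L : 'rV[R]_m -> W) = fun u => \sum_j u 0 j *: L (delta_mx 0 j)).
  apply: (Ck_continuous (k := 0) (U := setT)) => //.
  apply: Ck_sum; first exact: openT.
  move=> j; apply: Ck_scale; [exact: openT| |exact: Ck_cst].
  by apply: (Ck_lin _ (L := coordL 0 j)); exact: coord_continuous.
apply/funext => u; rewrite {1}(row_sum_delta u) linear_sum.
by apply: eq_bigr => j _; rewrite linearZ.
Qed.

Lemma Ck_coord V m k (f : V -> 'rV[R]_m) (U : set V) j : open U ->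
  Ck k f U -> Ck k (fun x => f x 0 j) U.
Proof.
by move=> oU; apply: (Ck_lincomp (L := coordL 0 j)) => //; exact: coord_continuous.
Qed.

Lemma Ck_rV V m k (f : V -> 'rV[R]_m) (U : set V) : open U ->
  (forall j, Ck k (fun x => f x 0 j) U) -> Ck k f U.
Proof.
move=> oU Cf.
apply: (Ck_ext (f := fun x => \sum_j f x 0 j *: (delta_mx 0 j : 'rV[R]_m))) => //.
  by move=> x _; rewrite -row_sum_delta.
by apply: Ck_sum => // j; apply: Ck_scale => //; exact: Ck_cst.
Qed.

Lemma derive_rV W m (g : 'rV[R]_m -> W) x v : differentiable g x ->
  'D_v g x = \sum_j v 0 j *: 'D_(delta_mx 0 j) g x.
Proof.
move=> dg; rewrite deriveE // {1}(row_sum_delta v) linear_sum.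
by apply: eq_bigr => j _; rewrite linearZ deriveE.
Qed.

Lemma derive_comp V W W' (f : V -> W) (g : W -> W') x v :
  differentiable f x -> differentiable g (f x) ->
  'D_v (g \o f) x = 'D_('D_v f x) g (f x).
Proof.
move=> df dg; rewrite !deriveE //; last exact: differentiable_comp.
by rewrite diff_comp.
Qed.

(** By the chain rule, [g] is differentiated in the direction ['D_v f x], which moves with [x],
    whereas [Ck] only speaks of fixed directions. Expanding in the basis of the middle space cures
    this, which is why that space is one of row vectors. *)
Lemma Ck_comp V W m k (f : V -> 'rV[R]_m) (g : 'rV[R]_m -> W) (U : set V)
    (O : set 'rV[R]_m) : open U -> open O -> (forall x, U x -> O (f x)) ->
  Ck k f U -> Ck k g O -> Ck k (fun x => g (f x)) U.
Proof.
move=> oU oO fUO; elim: k g => [|k IH] g.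
  by move=> cf cg x Ux; apply: continuous_comp; [exact: cf|exact: cg (fUO _ Ux)].
move=> Cf Cg; have [df Df] := Cf; have [dg Dg] := Cg; split=> [x Ux|v].
  by apply: differentiable_comp; [exact: df|exact: dg (fUO _ Ux)].
have C : Ck k (fun x => \sum_j 'D_v f x 0 j *: 'D_(delta_mx 0 j) g (f x)) U.
  apply: Ck_sum => // j; apply: Ck_scale => //; first exact: Ck_coord (Df v).
  exact: (IH ('D_(delta_mx 0 j) g)) (Ck_pred Cf) (Dg _).
apply: Ck_ext oU _ C => x Ux /=.
rewrite -derive_rV; last exact: dg (fUO _ Ux).
by rewrite -derive_comp //; [exact: df|exact: dg (fUO _ Ux)].
Qed.

Lemma Ck_mul V k (a b : V -> R) (U : set V) : open U ->
  Ck k a U -> Ck k b U -> Ck k (fun x => a x * b x) U.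
Proof. exact: Ck_scale. Qed.

Lemma Ck_mulmx V m p k (f : V -> 'rV[R]_m) (A : V -> 'M[R]_(m, p)) (U : set V) :
  open U -> Ck k f U -> (forall i j, Ck k (fun x => A x i j) U) ->
  Ck k (fun x => f x *m A x) U.
Proof.
move=> oU Cf CA; apply: Ck_rV => // j.
apply: (Ck_ext (f := fun x => \sum_i f x 0 i * A x i j)) => //.
  by move=> x _; rewrite mxE.
by apply: Ck_sum => // i; apply: Ck_mul => //; exact: Ck_coord.
Qed.

Lemma Ck_mulmxc V m p k (f : V -> 'rV[R]_m) (A : 'M[R]_(m, p)) (U : set V) :
  open U -> Ck k f U -> Ck k (fun x => f x *m A) U.
Proof. by move=> oU Cf; apply: Ck_mulmx => // i j; exact: Ck_cst. Qed.

Lemma Ck_prod V k (I : Type) (r : seq I) (F : I -> V -> R) (U : set V) : open U ->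
  (forall i, Ck k (F i) U) -> Ck k (fun x => \prod_(i <- r) F i x) U.
Proof.
move=> oU cF; elim: r => [|i r IH].
  by under eq_fun do rewrite big_nil; exact: Ck_cst.
by under eq_fun do rewrite big_cons; exact: Ck_mul.
Qed.

Lemma Ck_det V m k (A : V -> 'M[R]_m) (U : set V) : open U ->
  (forall i j, Ck k (fun x => A x i j) U) -> Ck k (fun x => \det (A x)) U.
Proof.
move=> oU CA; rewrite /determinant; apply: Ck_sum => // s.
by apply: Ck_mul => //; [exact: Ck_cst|exact: Ck_prod].
Qed.

(** Cramer's formula reduces inversion to determinants and one scalar inverse. *)
Lemma Ck_invmx V m k (A : V -> 'M[R]_m) (U : set V) : open U ->
  (forall x, U x -> A x \in unitmx) ->
  (forall i j, Ck k (fun x => A x i j) U) ->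
  forall i j, Ck k (fun x => invmx (A x) i j) U.
Proof.
move=> oU uA CA i j.
apply: (Ck_ext (f := fun x => (\det (A x))^-1 * cofactor (A x) j i)) => //.
  by move=> x Ux; rewrite /invmx uA // !mxE.
apply: Ck_mul => //.
  apply: Ck_inv => //; last exact: Ck_det.
  by move=> x Ux; have := uA x Ux; rewrite unitmxE unitfE.
rewrite /cofactor; apply: Ck_mul => //; first exact: Ck_cst.
by apply: Ck_det => // a b; under eq_fun do rewrite !mxE; exact: CA.
Qed.

Lemma is_derive_line V W (f : V -> W) x d (s : R) :
  differentiable f (x + s *: d) ->
  is_derive s 1 (fun s => f (x + s *: d)) ('D_d f (x + s *: d)).
Proof.
move=> df; pose l s : V := x + s *: d.
have dl : is_diff s l (0 + *:%R^~ d : R -> V) by exact: is_diffD.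
have dlv : differentiable l s by case: dl.
have dc : differentiable (f \o l) s by exact: differentiable_comp.
rewrite -/(f \o l); apply: DeriveDef; first exact: diff_derivable.
rewrite derive_comp //; congr ('D_ _ f _).
by rewrite deriveE // diff_val !fctE add0r scale1r.
Qed.

Lemma MVT_line V (f : V -> R) x d :
  (forall s : R, 0 <= s <= 1 -> differentiable f (x + s *: d)) ->
  exists2 c : R, 0 < c < 1 & f (x + d) - f x = 'D_d f (x + c *: d).
Proof.
move=> df; pose h (s : R) := f (x + s *: d).
have dh (s : R) : 0 <= s <= 1 -> is_derive s 1 h ('D_d f (x + s *: d)).
  by move=> /df; exact: is_derive_line.
have [|s s01||c c01] := @MVT _ h (fun s => 'D_d f (x + s *: d)) 0 1.
- exact: ltr01.
- by apply: dh; move: s01; rewrite in_itv /= => /andP[/ltW -> /ltW ->].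
- apply: derivable_within_continuous => s.
  by rewrite in_itv /= => /dh[].
rewrite /h scale1r scale0r addr0 subr0 mulr1 => E; exists c => //.
Qed.

(** The sum of the norms of the partial derivatives is continuous and vanishes at [x0], hence is
    below [e] on a ball; the mean value theorem is then applied to each coordinate along segments of
    that ball. *)
Lemma small_derivative_lipschitz m n (r : 'rV[R]_m -> 'rV[R]_n) x0 U (e : R) :
  open U -> U x0 -> Ck 1 r U -> (forall v, 'D_v r x0 = 0) -> 0 < e ->
  exists2 d : R, 0 < d & ball x0 d `<=` U /\
    forall x y, ball x0 d x -> ball x0 d y -> `|r x - r y| <= e * `|x - y|.
Proof.
move=> oU Ux0 [dr Dr] r0 e0.
have C0 : Ck 0 (fun x => \sum_i `|'D_(delta_mx 0 i) r x|) U.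
  apply: Ck_sum => // i x Ux.
  by apply: continuous_comp; [exact: Dr|exact: norm_continuous].
have := C0 x0 Ux0; rewrite /prop_for /continuous_at.
rewrite big1 => [/cvgrPdist_lt /(_ e e0) near0|i _]; last by rewrite r0 normr0.
have nU : nbhs x0 U by exact: open_nbhs_nbhs.
have nN : nbhs x0 (U `&` [set x | `|0 - \sum_i `|'D_(delta_mx 0 i) r x| | < e]).
  exact: filterI.
have [d /= d0 dU] := (nbhs_ballP _ _).1 nN.
exists d => //; split=> [x /dU []//|x y Bx By].
apply: norm_coord => [|i j]; first by rewrite mulr_ge0 // ltW.
have Bz (s : R) : 0 <= s <= 1 -> ball x0 d (y + s *: (x - y)).
  move=> /andP[s0 s1]; move: Bx By; rewrite -!ball_normE /= => Bx By.
  have -> : x0 - (y + s *: (x - y)) = s *: (x0 - x) + (1 - s) *: (x0 - y).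
    by apply/rowP => k; rewrite !mxE; ring.
  rewrite (le_lt_trans (ler_normD _ _)) // !normrZ ger0_norm // ger0_norm ?subr_ge0 //.
  have [->|s0'] := eqVneq s 0; first by rewrite mul0r add0r subr0 mul1r.
  have sp : 0 < s by rewrite lt_neqAle eq_sym s0'.
  have : s * `|x0 - x| < s * d by rewrite ltr_pM2l.
  have : (1 - s) * `|x0 - y| <= (1 - s) * d by rewrite ler_wpM2l ?subr_ge0 // ltW.
  lra.
pose f z := coordL i j (r z).
have df z : U z -> differentiable f z.
  move=> Uz; apply: differentiable_comp; first exact: dr.
  exact/linear_differentiable/coord_continuous.
have [|c c01 E] := @MVT_line _ f y (x - y).
  by move=> s /Bz /dU [Uz _]; exact: df.
have Bc : ball x0 d (y + c *: (x - y)) by apply: Bz; case/andP: c01 => /ltW -> /ltW ->.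
have [Uc Ec] := dU _ Bc.
have -> : (r x - r y) i j = f (y + (x - y)) - f y by rewrite [y + _]addrC subrK /f /= !mxE.
rewrite E (derive_comp (g := coordL i j)); last first.
- exact/linear_differentiable/coord_continuous.
- exact: dr.
rewrite derive_lin; last exact: coord_continuous.
apply: le_trans (coord_norm _ _ _) _.
rewrite derive_rV; last exact: dr.
rewrite (le_trans (ler_norm_sum _ _ _)) //.
apply: le_trans (_ : \sum_i0 `|x - y| * `|'D_(delta_mx 0 i0) r (y + c *: (x - y))| <= _).
  by apply: ler_sum => k _; rewrite normrZ ler_wpM2r // coord_norm.
rewrite -mulr_sumr mulrC ler_wpM2r //; apply: ltW.
by apply: le_lt_trans Ec; rewrite sub0r normrN ler_norm.
Qed.

Lemma mulmx_inj_unit m (A : 'M[R]_m) :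
  (forall v : 'rV[R]_m, v *m A = 0 -> v = 0) -> A \in unitmx.
Proof.
move=> inj; rewrite -row_free_unit -kermx_eq0; apply/eqP/row_matrixP => i.
by rewrite row0; apply: inj; rewrite -row_mul mulmx_ker row0.
Qed.

Lemma mulmx_bound m n (A : 'M[R]_(m, n)) :
  exists2 K : R, 0 < K & forall v : 'rV[R]_m, `|v *m A| <= K * `|v|.
Proof.
have [K K0 KP] := linear_lipschitz (@linear_rV_continuous _ _ (mulmxr A : {linear 'rV[R]_m -> 'rV[R]_n})).
by exists K.
Qed.

End Matrices.

(** * The inverse function theorem *)

Section InverseFunction.
Set Implicit Arguments. Unset Strict Implicit.
Context {R : realType}.

Lemma near_normP (V : normedModType R) (x : V) (P : set V) :
  (\forall y \near x, P y) <->
  exists2 d : R, 0 < d & forall y, `|y - x| < d -> P y.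
Proof.
split=> [/nbhs_ballP[d /= d0 dP]|[d d0 dP]].
  by exists d => // y yx; apply: dP; rewrite -ball_normE /= distrC.
by apply/nbhs_ballP; exists d => //= y; rewrite -ball_normE /= distrC; exact: dP.
Qed.

Lemma norm_compact n (x0 : 'rV[R]_n) (d : R) : compact [set x | `|x0 - x| <= d].
Proof.
apply: bounded_closed_compact.
  exists (`|x0| + d); split; first exact: num_real.
  move=> M hM x /= hx; apply: le_trans (ltW hM).
  rewrite (_ : x = x0 - (x0 - x)); first by rewrite (le_trans (ler_normB _ _)) // lerD2l.
  by apply/rowP => i; rewrite !mxE; ring.
rewrite (_ : [set x | _] = (fun x => `|x0 - x|) @^-1` [set y | y <= d]) //.
apply: (@closed_comp _ _ (fun x : 'rV[R]_n => `|x0 - x|)); last exact: closed_le.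
move=> x _; apply: continuous_comp; last exact: norm_continuous.
by apply: continuousB; [exact: cst_continuous|exact: cvg_id].
Qed.

(* Edelstein's argument: on a compact ball, the minimum of the displacement
   [|x - T x|] is attained, and at a minimiser it must vanish. *)
Lemma contraction_onto n (r : 'rV[R]_n -> 'rV[R]_n) (x0 : 'rV[R]_n) (d : R) : 0 <= d ->
  (forall x, `|x0 - x| <= d -> {for x, continuous r}) ->
  (forall x y, `|x0 - x| <= d -> `|x0 - y| <= d -> `|r x - r y| <= 2^-1 * `|x - y|) ->
  forall c, `|x0 - (c + r x0)| <= d / 2 ->
  exists2 x, `|x0 - x| <= d & x = c + r x.
Proof.
move=> d0 cr lipr c hc; pose T x := c + r x.
have TB x : `|x0 - x| <= d -> `|x0 - T x| <= d.
  move=> Bx; have B0 : `|x0 - x0| <= d by rewrite subrr normr0.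
  have -> : x0 - T x = (x0 - (c + r x0)) + (r x0 - r x).
    by rewrite /T; apply/rowP => i; rewrite !mxE; ring.
  have := ler_normD (x0 - (c + r x0)) (r x0 - r x); have := lipr _ _ B0 Bx.
  by move: Bx hc; lra.
have [||x xB xmin] := @EVT_min_rV _ _ (fun x => `|x - T x|) _ _ (@norm_compact n x0 d).
- by exists x0; rewrite /= subrr normr0.
- apply: continuous_in_subspaceT => x; rewrite inE /= => Bx.
  apply: continuous_comp; last exact: norm_continuous.
  apply: continuousB; first exact: cvg_id.
  by apply: continuousD; [exact: cst_continuous|exact: cr].
move: xB; rewrite inE /= => Bx; exists x => //; apply/eqP; rewrite -subr_eq0 -normr_eq0.
have BT := TB _ Bx; have := xmin (T x); rewrite inE /= => /(_ BT).
have := lipr _ _ Bx BT.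
rewrite (_ : r x - r (T x) = T x - T (T x)); last by apply/rowP => i; rewrite !mxE; ring.
have := normr_ge0 (x - T x); rewrite -/(T x) eq_le => ->; rewrite andbT; lra.
Qed.

(** The expansion bound on [f] does double duty: it forbids a kernel of the Jacobian, along which
    [f] would move only to second order of smallness, and it makes [g] Lipschitz, so that the
    remainder of [f] is also a remainder for [g]. *)
Lemma inverse_is_diff n (f g : 'rV[R]_n -> 'rV[R]_n) (U W : set 'rV[R]_n) w (K : R) :
  open U -> open W -> W w -> 0 < K ->
  (forall v, W v -> U (g v) /\ f (g v) = v) ->
  (forall x y, U x -> U y -> `|x - y| <= K * `|f x - f y|) ->
  differentiable f (g w) ->
  jacobian f (g w) \in unitmx /\
  is_diff w g (mulmxr (invmx (jacobian f (g w))) : 'rV[R]_n -> 'rV[R]_n).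
Proof.
move=> oU oW Ww K0 gW lipf df; have [Ugw fgw] := gW _ Ww.
pose J := jacobian f (g w).
have dE h : 'd f (g w) h = h *m J by rewrite -deriveE // deriveEjacobian.
have nU : \forall y \near g w, U y by exact: open_nbhs_nbhs.
have nW : \forall y \near w, W y by exact: open_nbhs_nbhs.
have feps (e : R) : 0 < e -> exists2 d : R, 0 < d &
    forall h, `|h| < d -> U (g w + h) /\ `|f (g w + h) - f (g w) - h *m J| <= e * `|h|.
  move=> e0; have [d1 d10 h1] := (near_normP _ _).1 (diff_eps df e0).
  have [d2 d20 h2] := (near_normP _ _).1 nU.
  exists (Num.min d1 d2); first by rewrite lt_min d10.
  move=> h; rewrite lt_min => /andP[hd1 hd2]; split.
    by apply: h2; rewrite addrC addKr.
  by have := h1 h; rewrite subr0 dE; exact.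
have uJ : J \in unitmx.
  apply: mulmx_inj_unit => v vJ; apply/eqP/negPn/negP => v0.
  have nv : 0 < `|v| by rewrite normr_gt0.
  (* With this precision a kernel vector of norm [d / 2] would satisfy [d / 2 <= d / 4]. *)
  have [|d d0 hd] := feps (2 * K)^-1; first by rewrite invr_gt0 mulr_gt0.
  pose h := (d / 2 / `|v|) *: v.
  have nh : `|h| = d / 2.
    by rewrite normrZ ger0_norm ?divr_ge0 ?ltW // divfK // gt_eqF.
  have [|Uh] := hd h; first by rewrite nh; lra.
  rewrite /h -scalemxAl vJ scaler0 subr0 -/h nh => fh.
  have := lipf _ _ Uh Ugw; rewrite addrC addKr nh => le1.
  have : K * `|f (g w + h) - f (g w)| <= K * ((2 * K)^-1 * (d / 2)).
    by rewrite ler_pM2l.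
  have -> : K * ((2 * K)^-1 * (d / 2)) = d / 4 by field; rewrite gt_eqF.
  by move: le1; lra.
split=> //; rewrite -/J; apply: is_diff_eps; first exact: linear_rV_continuous.
move=> e e0.
have [C C0 CP] := mulmx_bound (invmx J).
(* [C] is lost on applying the inverse Jacobian and [K] on bounding the increment of [g]. *)
have [|d d0 hd] := feps (e / (C * K)); first by rewrite divr_gt0 // mulr_gt0.
have [dW dW0 hW] := (near_normP _ _).1 nW.
apply/near_normP; exists (Num.min dW (d / K)).
  by rewrite lt_min dW0 divr_gt0.
move=> k; rewrite subr0 lt_min => /andP[kW kd].
have Wk : W (w + k) by apply: hW; rewrite addrC addKr.
have [Uk fk] := gW _ Wk.
pose h := g (w + k) - g w.
have gh : g (w + k) = g w + h by rewrite /h subrKC.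
have nh : `|h| <= K * `|k|.
  by have := lipf _ _ Uk Ugw; rewrite fk fgw -/h (addrC w) addrK.
have [|_] := hd h.
  by apply: le_lt_trans nh _; rewrite mulrC -ltr_pdivlMr.
rewrite -gh fk fgw [w + k - w]addrAC subrr add0r => kh.
have -> : g (w + k) - g w - mulmxr (invmx J) k = - ((k - h *m J) *m invmx J).
  by rewrite /= mulmxBl mulmxK // opprB.
rewrite normrN; apply: le_trans (CP _) _.
have : C * `|k - h *m J| <= C * (e / (C * K) * (K * `|k|)).
  rewrite ler_pM2l //; apply: le_trans kh _.
  by rewrite ler_wpM2l // ltW // divr_gt0 // mulr_gt0.
suff -> : C * (e / (C * K) * (K * `|k|)) = e * `|k| by [].
by field; rewrite !gt_eqF.
Qed.

(** Newton's map: [r x = x - f x *m invmx J] has zero derivative at [x0], so it contracts near [x0],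
    and solving [f x = w] is the fixed-point equation [x = w *m invmx J + r x]. *)
Theorem inverse_function n k (f : 'rV[R]_n -> 'rV[R]_n) x0 (U : set 'rV[R]_n) :
  open U -> U x0 -> Ck k.+1 f U -> (forall v, 'D_v f x0 = 0 -> v = 0) ->
  exists A W (g : 'rV[R]_n -> 'rV[R]_n),
    [/\ open A, A x0 & A `<=` U] /\
    [/\ open W, Ck k.+1 g W, forall x, A x -> W (f x) /\ g (f x) = x &
        forall w, W w -> A (g w) /\ f (g w) = w].
Proof.
move=> oU Ux0 Cf inj; have [df Df] := Cf.
pose J := jacobian f x0.
have JE v : 'D_v f x0 = v *m J by rewrite deriveEjacobian //; exact: df.
have uJ : J \in unitmx by apply: mulmx_inj_unit => v; rewrite -JE; exact: inj.
pose r x := x - f x *m invmx J.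
have Cr : Ck 1 r U.
  apply: Ck_add => //; first exact: Ck_id.
  by apply: Ck_opp => //; apply: Ck_mulmxc => //; exact: Ck_le Cf.
have r0 v : 'D_v r x0 = 0.
  have dM : differentiable (mulmxr (invmx J) : 'rV[R]_n -> 'rV[R]_n) (f x0).
    by apply: linear_differentiable; exact: linear_rV_continuous.
  have dfx := df _ Ux0.
  have dc : differentiable ((mulmxr (invmx J) : 'rV[R]_n -> 'rV[R]_n) \o f) x0.
    exact: differentiable_comp.
  rewrite (_ : r = id - ((mulmxr (invmx J) : 'rV[R]_n -> 'rV[R]_n) \o f)) //.
  rewrite deriveB ?derive_id; [|exact: derivable_id|exact: diff_derivable].
  rewrite derive_comp // derive_lin; last exact: linear_rV_continuous.
  by rewrite /= JE mulmxK // subrr.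
have h0 : (0 : R) < 2^-1 by rewrite invr_gt0 ltr0n.
have [d d0 [dU lipr]] := small_derivative_lipschitz oU Ux0 Cr r0 h0.
have [C C0 CP] := mulmx_bound (invmx J).
have K0 : 0 < 2 * C by rewrite mulr_gt0.
have lipf x y : ball x0 d x -> ball x0 d y -> `|x - y| <= (2 * C) * `|f x - f y|.
  move=> Bx By; have := lipr _ _ Bx By; have := CP (f x - f y).
  have := ler_normD (r x - r y) ((f x - f y) *m invmx J).
  rewrite (_ : r x - r y + (f x - f y) *m invmx J = x - y); first lra.
  by rewrite mulmxBl; apply/rowP => i; rewrite !mxE; ring.
have oB : open (ball x0 d) by exact: ball_open.
have Bx0 : ball x0 d x0 by exact: ballxx.
(* Moves the starting point of the fixed-point equation by at most [d / 8], within the quarter of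
   [d] that [contraction_onto] allows on the ball of radius [d / 2]. *)
pose c := d / 8 / C.
have c0 : 0 < c by rewrite !divr_gt0 // ltr0n.
pose g w := get [set x | ball x0 d x /\ f x = w].
have gP w : `|w - f x0| < c -> ball x0 d (g w) /\ f (g w) = w.
  move=> wc; apply: (@getPex _ [set x | ball x0 d x /\ f x = w]).
  have in2 x : `|x0 - x| <= d / 2 -> ball x0 d x.
    by rewrite -ball_normE /= => /le_lt_trans; apply; lra.
  have [||x y||x Bx Ex] := @contraction_onto n r x0 (d / 2) _ _ _ (w *m invmx J).
  - lra.
  - by move=> x /in2/dU Ux; exact: (Ck_continuous Cr Ux).
  - by move=> /in2 Bx /in2 By; exact: lipr.
  - rewrite (_ : x0 - _ = - ((w - f x0) *m invmx J)); last first.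
      by rewrite mulmxBl /r; apply/rowP => i; rewrite !mxE; ring.
    rewrite normrN; apply: le_trans (CP _) _.
    have : C * `|w - f x0| <= C * c by rewrite ler_pM2l // ltW.
    have -> : C * c = d / 8 by rewrite /c; field; rewrite gt_eqF.
    lra.
  exists x; split; first exact: in2.
  have : (f x - w) *m invmx J = 0.
    rewrite mulmxBl; apply/rowP => i; move: Ex; rewrite /r => /rowP /(_ i).
    by rewrite !mxE; lra.
  move=> /(congr1 (mulmx^~ J)); rewrite mulmxKV // mul0mx => /eqP.
  by rewrite subr_eq0 => /eqP.
pose W := ball (f x0) c.
have oW : open W by exact: ball_open.
have WP w : W w -> `|w - f x0| < c by rewrite /W -ball_normE /= distrC.
pose A := ball x0 d `&` f @^-1` W.
have oA : open A.
  rewrite openE => x [Bx Wx]; apply: filterI.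
    exact: open_nbhs_nbhs.
  have := Ck_continuous Cf (dU _ Bx); apply.
  exact: open_nbhs_nbhs.
exists A, W, g; split.
  split=> //; last by move=> x [/dU].
  by split=> //; exact: ballxx.
have gA w : W w -> A (g w) /\ f (g w) = w.
  by move=> Ww; have [Bg fg] := gP _ (WP _ Ww); split=> //; split=> //; rewrite /preimage /= fg.
have gW w : W w -> ball x0 d (g w) /\ f (g w) = w by move/WP; exact: gP.
have ID w : W w -> jacobian f (g w) \in unitmx /\
    is_diff w g (mulmxr (invmx (jacobian f (g w))) : 'rV[R]_n -> 'rV[R]_n).
  move=> Ww; apply: (@inverse_is_diff _ f g _ W w _ oB oW Ww K0 gW lipf).
  by apply: df; apply: dU; exact: (gW _ Ww).1.
split=> //; last first.
  move=> x [Bx Wx]; split=> //.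
  have [Bg fg] := gW _ Wx.
  apply/eqP; rewrite -subr_eq0 -normr_le0.
  by have := lipf _ _ Bg Bx; rewrite fg subrr normr0 mulr0.
(* Bootstrap: the derivative of [g] at [w] is the inverse Jacobian of [f] at [g w], so [C^j]
   regularity of [g] gives [C^(j+1)] as long as [f] allows it. *)
suff Cg j : (j <= k.+1)%N -> Ck j g W by exact: Cg.
elim: j => [_ w Ww|j IH jk].
  by apply: differentiable_continuous; have [_ []] := ID _ Ww.
split=> [w Ww|v]; first by have [_ []] := ID _ Ww.
have Cgj : Ck j g W by apply: IH; exact: ltnW.
have : Ck j (fun w => v *m invmx (jacobian f (g w))) W.
  apply: (Ck_mulmx oW (@Ck_cst _ _ _ _ v _)).
  apply: (@Ck_invmx _ _ _ _ (fun w => jacobian f (g w)) W oW).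
    by move=> w /ID[].
  move=> a b.
  apply: (Ck_ext (f := fun w => ('D_(delta_mx 0 a) f (g w)) 0 b)) => //.
    move=> w Ww; rewrite deriveEjacobian; last by apply: df; apply: dU; exact: (gW _ Ww).1.
    by rewrite -rowE mxE.
  apply: Ck_coord => //.
  apply: (@Ck_comp _ _ _ _ _ g ('D_(delta_mx 0 a) f) W (ball x0 d)) => //.
    by move=> w /gW[].
  by apply: Ck_sub dU _; exact: Ck_le (Df _).
apply: Ck_ext => // w Ww /=.
have [_ dg] := ID _ Ww; rewrite deriveE; last by case: dg.
by rewrite diff_val.
Qed.

End InverseFunction.

(** * Euclidean geometry of row vectors *)

Section InnerProduct.
Set Implicit Arguments. Unset Strict Implicit.
Context {R : realType} {n : nat}.
Local Notation E := 'rV[R]_n.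
Implicit Types x y z : E.

Lemma innerE x y : inner x y = \sum_j x 0 j * y 0 j.
Proof. by rewrite /inner mxE; apply: eq_bigr => j _; rewrite mxE. Qed.

Lemma innerC x y : inner x y = inner y x.
Proof. by rewrite !innerE; apply: eq_bigr => j _; rewrite mulrC. Qed.

Lemma innerDl x y z : inner (x + y) z = inner x z + inner y z.
Proof. by rewrite /inner mulmxDl mxE. Qed.

Lemma innerZl (a : R) x z : inner (a *: x) z = a * inner x z.
Proof. by rewrite /inner -scalemxAl mxE. Qed.

Lemma innerNl x z : inner (- x) z = - inner x z.
Proof. by rewrite -scaleN1r innerZl mulN1r. Qed.

Lemma innerDr x y z : inner x (y + z) = inner x y + inner x z.
Proof. by rewrite !(innerC x) innerDl. Qed.

Lemma innerZr (a : R) x z : inner x (a *: z) = a * inner x z.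
Proof. by rewrite !(innerC x) innerZl. Qed.

Lemma innerNr x z : inner x (- z) = - inner x z.
Proof. by rewrite !(innerC x) innerNl. Qed.

Lemma inner0l x : inner 0 x = 0.
Proof. by rewrite -(scale0r 0) innerZl mul0r. Qed.

Lemma inner0r x : inner x 0 = 0.
Proof. by rewrite innerC inner0l. Qed.

Definition innerlin := (innerDl, innerDr, innerNl, innerNr, innerZl, innerZr).

Lemma inner_ge0 x : 0 <= inner x x.
Proof. by rewrite innerE sumr_ge0 // => j _; rewrite -expr2 sqr_ge0. Qed.

Lemma inner_mulmx x y (A : 'M[R]_n) : inner (x *m A) y = inner x (y *m A^T).
Proof. by rewrite /inner trmx_mul trmxK mulmxA. Qed.

Lemma enorm_ge0 x : 0 <= enorm x. Proof. exact: sqrtr_ge0. Qed.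

Lemma enorm_sqr x : enorm x ^+ 2 = inner x x.
Proof. by rewrite sqr_sqrtr // inner_ge0. Qed.

Lemma norm_sqr_le_inner x : `|x| ^+ 2 <= inner x x.
Proof.
rewrite -ler_sqrt ?inner_ge0 // sqrtr_sqr ger0_norm //.
apply: norm_coord; first exact: sqrtr_ge0.
move=> i j; rewrite -(sqrtr_sqr (x i j)) ler_sqrt ?inner_ge0 // ord1 innerE.
rewrite (bigD1 j) //= -expr2 lerDl sumr_ge0 // => k _.
by rewrite -expr2 sqr_ge0.
Qed.

Lemma norm_le_enorm x : `|x| <= enorm x.
Proof.
rewrite /enorm -(ger0_norm (normr_ge0 x)) -sqrtr_sqr ler_sqrt ?inner_ge0 //.
exact: norm_sqr_le_inner.
Qed.

(** Row vectors carry the sup norm. The crude constant [n.+1] remains positive for [n = 0], so it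
    can be divided by later. *)
Lemma inner_le_norm x y : inner x y <= n.+1%:R * `|x| * `|y|.
Proof.
rewrite innerE; apply: le_trans (_ : \sum_(j < n) `|x| * `|y| <= _).
  apply: ler_sum => j _; apply: le_trans (ler_norm _) _.
  by rewrite normrM ler_pM ?coord_norm.
rewrite sumr_const card_ord -[_ *+ n]mulr_natl -mulrA ler_wpM2r ?mulr_ge0 //.
by rewrite ler_nat.
Qed.

Lemma enorm_le_norm x : enorm x <= n.+1%:R * `|x|.
Proof.
rewrite -[leRHS]ger0_norm ?mulr_ge0 // -sqrtr_sqr ler_sqrt ?sqr_ge0 //.
apply: le_trans (inner_le_norm _ _) _.
rewrite exprMn -mulrA -expr2 ler_wpM2r ?sqr_ge0 //.
by rewrite ler_eXnr // ler1n.
Qed.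

Lemma inner_eq0 x : inner x x <= 0 -> x = 0.
Proof.
move=> x0; apply/eqP; rewrite -normr_eq0 -sqrf_eq0 eq_le sqr_ge0 andbT.
exact: le_trans (norm_sqr_le_inner x) x0.
Qed.

Lemma inner_le_enorm x y : inner x y <= enorm x * enorm y.
Proof.
have [->|x0] := eqVneq x 0; first by rewrite inner0l mulr_ge0 ?enorm_ge0.
have xp : 0 < inner x x.
  by rewrite lt_neqAle inner_ge0 andbT eq_sym; apply: contra x0 => /eqP E; apply/eqP/inner_eq0; rewrite E.
(* This square equals [inner x x] times the Cauchy-Schwarz defect. *)
have : 0 <= inner (inner x x *: y - inner x y *: x) (inner x x *: y - inner x y *: x).
  exact: inner_ge0.
rewrite !innerlin (innerC y x) => h.
have {h} : 0 <= inner x x * (inner x x * inner y y - inner x y ^+ 2) by nra.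
rewrite pmulr_rge0 // subr_ge0 => h.
apply: le_trans (ler_norm _) _.
rewrite -sqrtr_sqr /enorm -sqrtrM ?inner_ge0 // ler_sqrt //.
by rewrite mulr_ge0 ?inner_ge0.
Qed.

Lemma enormN x : enorm (- x) = enorm x.
Proof. by rewrite /enorm !innerlin opprK. Qed.

Lemma enormZ (a : R) x : enorm (a *: x) = `|a| * enorm x.
Proof.
by rewrite /enorm !innerlin mulrA -expr2 sqrtrM ?sqr_ge0 // sqrtr_sqr.
Qed.

Lemma enormD x y : enorm (x + y) <= enorm x + enorm y.
Proof.
rewrite -[leRHS]ger0_norm ?addr_ge0 ?enorm_ge0 // -sqrtr_sqr ler_sqrt ?sqr_ge0 //.
rewrite !innerlin sqrrD !enorm_sqr (innerC y x).
by have := inner_le_enorm x y; lra.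
Qed.

Lemma Ck_inner (V : normedModType R) k (f g : V -> E) (U : set V) : open U ->
  Ck k f U -> Ck k g U -> Ck k (fun u => inner (f u) (g u)) U.
Proof.
move=> oU Cf Cg; apply: (Ck_ext (f := fun u => \sum_j f u 0 j * g u 0 j)) => //.
  by move=> u _; rewrite innerE.
by apply: Ck_sum => // j; apply: Ck_mul => //; exact: Ck_coord.
Qed.

(** The definitions of the problem use the Euclidean norm, the topology the sup norm; this is the
    bridge. *)
Lemma near_enormP x (P : set E) : (\forall y \near x, P y) <->
  exists2 d : R, 0 < d & forall y, enorm (y - x) < d -> P y.
Proof.
split=> [/near_normP[d d0 dP]|[d d0 dP]].
  by exists d => // y /(le_lt_trans (norm_le_enorm _)); exact: dP.
apply/near_normP; exists (d / n.+1%:R); first by rewrite divr_gt0.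
move=> y yx; apply: dP; apply: le_lt_trans (enorm_le_norm _) _.
by rewrite mulrC -ltr_pdivlMr.
Qed.

Lemma open_enorm_ball x (d : R) : open [set y | enorm (y - x) < d].
Proof.
rewrite openE => y yd; apply/near_enormP; exists (d - enorm (y - x)).
  by rewrite subr_gt0.
move=> z zy /=; have -> : z - x = (z - y) + (y - x) by rewrite addrA subrK.
by apply: le_lt_trans (enormD _ _) _; move: yd zy => /=; lra.
Qed.

(** If the infimum [c] were not attained, lower semicontinuity would keep values near each point
    above [c] by some margin; compactness makes the margin uniform, contradicting the choice of [c].
    The bound [m] makes [c] finite. *)
Lemma lsc_compact_min (phi : E -> \bar R) (q : E -> R) (K : set E) x0 (m : R) :
  closed_fun phi -> continuous q -> compact K -> K x0 ->
  phi x0 \is a fin_num -> (forall x, K x -> m%:E <= phi x + (q x)%:E)%E ->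
  exists2 x, K x & forall y, K y -> (phi x + (q x)%:E <= phi y + (q y)%:E)%E.
Proof.
move=> lsc cq cK Kx0 fx0 bd; pose S := [set (phi x + (q x)%:E)%E | x in K].
have mS : (m%:E <= ereal_inf S)%E by apply: le_ereal_inf_tmp => _ [x Kx <-]; exact: bd.
have Sx : (ereal_inf S <= phi x0 + (q x0)%:E)%E by apply: ereal_inf_lbound; exists x0.
have [c cE] : exists c : R, ereal_inf S = c%:E.
  exists (fine (ereal_inf S)); rewrite fineK // fin_numElt.
  rewrite (lt_le_trans _ mS) ?ltNyr //=; apply: le_lt_trans Sx _.
  by rewrite -(fineK fx0) -EFinD ltry.
apply: contrapT => noM.
have gtc x : K x -> (c%:E < phi x + (q x)%:E)%E.
  move=> Kx; rewrite ltNge; apply/negP => le; apply: noM; exists x => // y Ky.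
  by apply: le_trans le _; rewrite -cE; apply: ereal_inf_lbound; exists y.
have [e e0 eP] : exists2 e : R, 0 < e & forall x, K x -> (c%:E + e%:E < phi x + (q x)%:E)%E.
  have /compact_near_coveringP cov := cK.
  have := cov R (0 : R)^'+ (fun e x => (c%:E + e%:E < phi x + (q x)%:E)%E) _.
  have H : forall x, K x -> \forall x' \near x & e \near (0 : R)^'+,
      (c%:E + e%:E < phi x' + (q x')%:E)%E.
    move=> x Kx.
    have [b cb bx] : exists2 b : R, c - q x < b & (b%:E < phi x)%E.
      have := gtc _ Kx; case: (phi x) => [p| |] //.
      - rewrite -EFinD lte_fin => h; exists ((c - q x + p) / 2); first lra.
        by rewrite lte_fin; lra.
      - by move=> _; exists (c - q x + 1); rewrite ?ltry //; lra.
    have [V nV hV] := lsc _ _ bx.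
    pose d := (b - (c - q x)) / 2.
    have d0 : 0 < d by rewrite /d; lra.
    have /cvgrPdist_lt/(_ _ d0) nq := cq x.
    exists (V `&` [set y | `|q x - q y| < d], [set e : R | e < d]).
      split; first exact: filterI.
      exact: nbhs_right_lt.
    move=> [y e] [/= [Vy qy] ed].
    have := hV _ Vy; case: (phi y) => [p| |] //; last by move=> _; rewrite addye // -EFinD ltry.
    rewrite -!EFinD !lte_fin => bp.
    have := ler_norm (q x - q y); rewrite /d in qy ed *; lra.
  move=> /(_ _ H) nP.
  have : \forall e \near (0 : R)^'+, 0 < e /\ K `<=` (fun x => (c%:E + e%:E < phi x + (q x)%:E)%E).
    by apply: filterI => //; exact: nbhs_right_gt.
  by move=> /filter_ex[e [e0 eP]]; exists e.
have : (c%:E + e%:E <= ereal_inf S)%E.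
  by apply: le_ereal_inf_tmp => _ [x Kx <-]; exact: ltW (eP _ Kx).
by rewrite cE -EFinD lee_fin; lra.
Qed.

End InnerProduct.

(** * Proximal maps of prox-regular functions *)

Section ProximalMap.
Set Implicit Arguments. Unset Strict Implicit.
Context {R : realType} {n : nat}.
Local Notation E := 'rV[R]_n.
Implicit Types (phi : E -> \bar R) (x y v xs : E) (t r eps : R).

(* The single constant [r] serves both for the global quadratic minorant at
   [xs] and as the local prox-regularity modulus; everything below works for
   [t < 1 / r]. *)
Record prox_model phi xs v eps r : Prop := ProxModel {
  pm_lsc : closed_fun phi;
  pm_proper : forall x, phi x != -oo%E;
  pm_eps : 0 < eps;
  pm_r : 0 < r;
  pm_sub : lsubdiff phi xs v;
  pm_minorant : forall x,
    (phi xs + (inner v (x - xs) - r / 2 * inner (x - xs) (x - xs))%:E <= phi x)%E;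
  pm_reg : forall x v', lsubdiff phi x v' -> enorm (v' - v) < eps ->
    enorm (x - xs) < eps -> (phi x < phi xs + eps%:E)%E ->
    forall y, enorm (y - xs) < eps ->
    (phi x + (inner v' (y - x) - r / 2 * inner (y - x) (y - x))%:E <= phi y)%E }.

Lemma rsubdiff_lsubdiff phi x v : rsubdiff phi x v -> lsubdiff phi x v.
Proof.
move=> rv; have [fx _] := rv; split=> //.
by exists (fun=> x), (fun=> v); split=> //; exact: cvg_cst.
Qed.

Lemma prox_regular_rsubdiff phi x v :
  prox_regular phi -> lsubdiff phi x v -> rsubdiff phi x v.
Proof.
move=> pr lv; have [fx _] := lv; split=> // e e0.
have [_ [eps [rho [eps0 rho0 H]]]] := pr _ _ lv.
(* Within this radius the quadratic defect is at most [e] times the distance; [rho + 1] guards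
   against [rho = 0]. *)
exists (Num.min eps (2 * e / (rho + 1))).
  by rewrite lt_min eps0 !divr_gt0 ?mulr_gt0 //; lra.
move=> y; rewrite lt_min => /andP[ye yr].
have z0 (z : E) : enorm (z - z) < eps by rewrite subrr /enorm inner0l sqrtr0.
have lt1 : (phi x < phi x + eps%:E)%E by rewrite -(fineK fx) -EFinD lte_fin; lra.
have Hy := H _ _ lv (z0 _) (z0 _) lt1 _ ye.
apply: le_trans Hy.
rewrite leeD2l // lee_fin lerD2l lerN2.
rewrite -enorm_sqr; move: yr; rewrite ltr_pdivlMr; last lra.
have := enorm_ge0 (y - x); nra.
Qed.

(** Inside the [eps]-ball prox-regularity gives the minorant. Outside it, prox-boundedness gives a
    quadratic lower bound with the wrong constant term, and [|x - xs| >= eps] lets the curvature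
    absorb that constant. *)
Lemma prox_model_exists phi xs v : proper_fun phi -> closed_fun phi ->
  prox_bounded phi -> prox_regular phi -> lsubdiff phi xs v ->
  exists eps r, prox_model phi xs v eps r.
Proof.
move=> [pr _] cl [t1 [y1 [t10 bd]]] reg lv.
have [_ [eps [rho [eps0 rho0 H]]]] := reg _ _ lv; have [fx _] := lv.
have [c hc] : exists c : R, forall x, (c%:E <= phi x + (qpen t1 y1 x)%:E)%E.
  move: bd; set I := ereal_inf _ => bd.
  have [c hc] : exists c : R, (c%:E <= I)%E.
    move: bd; case: I => [p| |] // _; first by exists p.
    by exists 0; rewrite leey.
  exists c => x; apply: le_trans hc _.
  by apply: ereal_inf_lbound; exists x.
pose a := fine (phi xs).
(* The constants left over after Young's inequality on [inner v (x - xs)] and recentring the penalty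
   from [y1] to [xs]; the curvature terms go into [r]. *)
pose B := a - c + inner v v / 2 + t1^-1 * inner (xs - y1) (xs - y1).
pose r := rho + 2 * (`|B| / eps ^+ 2 + 2^-1 + t1^-1).
have r1 : rho <= r.
  rewrite /r lerDl !mulr_ge0 ?addr_ge0 ?divr_ge0 ?invr_ge0 ?sqr_ge0 //; exact: ltW.
have r2 : 0 < r.
  have : 0 <= `|B| / eps ^+ 2 by rewrite divr_ge0 ?sqr_ge0.
  have : 0 < t1^-1 by rewrite invr_gt0.
  rewrite /r.
  lra.
have z0 (z : E) : enorm (z - z) < eps by rewrite subrr /enorm inner0l sqrtr0.
have lt1 : (phi xs < phi xs + eps%:E)%E by rewrite -(fineK fx) -EFinD lte_fin; lra.
have wk x v' y : (phi x + (inner v' (y - x) - rho / 2 * inner (y - x) (y - x))%:E <= phi y)%E ->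
    (phi x + (inner v' (y - x) - r / 2 * inner (y - x) (y - x))%:E <= phi y)%E.
  apply: le_trans; rewrite leeD2l // lee_fin lerD2l lerN2.
  by rewrite ler_wpM2r ?inner_ge0 //; lra.
exists eps, r; split=> //; last first.
  by move=> x v' l1 l2 l3 l4 y l5; apply: wk; exact: H.
move=> x; have [xe|xe] := ltP (enorm (x - xs)) eps; first by apply: wk; exact: H.
have := hc x; rewrite -[phi xs](fineK fx) -/a -EFinD.
have := pr x; case: (phi x) => [p| |] // _; last by move=> _; rewrite leey.
rewrite -EFinD !lee_fin /qpen.
have -> : x - y1 = (x - xs) + (xs - y1) by rewrite addrA subrK.
move: xe; set s := x - xs; set b := xs - y1 => xe.
have BE : B = a - c + inner v v / 2 + t1^-1 * inner b b by [].
have rE : r = rho + 2 * (`|B| / eps ^+ 2 + 2^-1 + t1^-1) by [].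
clearbody s b r B.
have s2 : eps ^+ 2 <= inner s s.
  by rewrite -enorm_sqr ler_sqr ?nnegrE ?enorm_ge0 // ltW.
have h1 : 0 <= inner (s - b) (s - b) by exact: inner_ge0.
have h2 : 0 <= inner (v - s) (v - s) by exact: inner_ge0.
move: h1 h2; rewrite !innerlin (innerC b s) (innerC s v) => h1 h2.
have h3 : `|B| <= `|B| / eps ^+ 2 * inner s s.
  rewrite mulrAC -mulrA -[leLHS]mulr1 ler_wpM2l // ler_pdivlMr ?mul1r //.
  exact: exprn_gt0.
have h4 := ler_norm B.
have t1i : 0 < t1^-1 by rewrite invr_gt0.
rewrite invfM => h5.
have h6 : 2^-1 / t1 * (inner s s + inner s b + (inner s b + inner b b)) <=
    t1^-1 * (inner s s + inner b b).
  by rewrite -mulrA mulrCA -subr_ge0 -mulrBr; apply: mulr_ge0; [exact: ltW|lra].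
have h7 := inner_ge0 s.
have h8 : 0 <= rho * inner s s by rewrite mulr_ge0.
rewrite rE; lra.
Qed.

(** Recentres the penalty at [xs]. Its linear term cancels the one in the minorant of [phi], leaving
    curvature and the displacement of [y] from [xs + t *: v]. *)
Lemma qpen_expand t y x xs v : 0 < t ->
  qpen t y x = qpen t y xs + (2 * t)^-1 * inner (x - xs) (x - xs) - inner v (x - xs)
    - t^-1 * inner (x - xs) (y - (xs + t *: v)).
Proof.
move=> t0; rewrite /qpen; set a := x - xs; set d := y - _.
have -> : xs - y = - (t *: v) - d by rewrite /d; apply/rowP => i; rewrite !mxE; ring.
have -> : x - y = a - t *: v - d by rewrite /d /a; apply/rowP => i; rewrite !mxE; ring.
clearbody a d; rewrite !innerlin (innerC v a) (innerC d a) (innerC d v).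
by field; rewrite gt_eqF.
Qed.

Lemma prox_subgrad phi t y x : 0 < t -> (forall x, phi x != -oo%E) ->
  (exists x, phi x \is a fin_num) -> prox t phi y x ->
  rsubdiff phi x (t^-1 *: (y - x)).
Proof.
move=> t0 pr [x0 fx0] px.
have fx : phi x \is a fin_num.
  rewrite fin_numE pr /=; apply/eqP => E; have := px x0.
  by rewrite E addye // -(fineK fx0) -EFinD.
split=> // e e0; exists (2 * t * e); first by rewrite !mulr_gt0.
move=> z zx; have := px z; rewrite -(fineK fx) -!EFinD.
have := pr z; case: (phi z) => [p| |] // _; last by move=> _; rewrite leey.
rewrite -EFinD !lee_fin.
(* With this subgradient the reference point is [y] itself, so the displacement term vanishes. *)
rewrite (@qpen_expand t y z x (t^-1 *: (y - x))) //.
rewrite scalerA mulfV ?gt_eqF // scale1r subrKC subrr inner0r mulr0 subr0 => h.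
have : (2 * t)^-1 * inner (z - x) (z - x) <= e * enorm (z - x).
  rewrite -enorm_sqr ler_pdivrMl ?mulr_gt0 // expr2 mulrA ler_wpM2r ?enorm_ge0 //.
  exact: ltW.
lra.
Qed.

End ProximalMap.

(** * Existence, localisation and uniqueness of proximal points *)

Section LocalProx.
Set Implicit Arguments. Unset Strict Implicit.
Context {R : realType} {n : nat}.
Local Notation E := 'rV[R]_n.
Implicit Types (phi : E -> \bar R) (x y v xs : E) (t r eps : R).

Lemma pm_fin phi xs v eps r : prox_model phi xs v eps r -> phi xs \is a fin_num.
Proof. by move=> pm; have [] := pm_sub pm. Qed.

Lemma prox_growth phi xs v eps r t y x : prox_model phi xs v eps r -> 0 < t ->
  (phi xs + (qpen t y xs + ((t^-1 - r) / 2 * inner (x - xs) (x - xs)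
     - t^-1 * inner (x - xs) (y - (xs + t *: v))))%:E <= phi x + (qpen t y x)%:E)%E.
Proof.
move=> pm t0; apply: le_trans (leeD2r _ (pm_minorant pm x)).
rewrite -addeA -EFinD leeD2l // lee_fin (qpen_expand y x xs v t0) invfM; lra.
Qed.

Lemma prox_exists phi xs v eps r t y : prox_model phi xs v eps r -> 0 < t < r^-1 ->
  exists x, prox t phi y x.
Proof.
move=> pm /andP[t0 tr]; have fx := pm_fin pm.
have rt : r < t^-1 by rewrite -[r]invrK ltf_pV2 ?posrE ?invr_gt0 //; exact: pm_r pm.
pose k := (t^-1 - r) / 2; have k0 : 0 < k by rewrite /k; lra.
pose b := t^-1 * enorm (y - (xs + t *: v)).
have b0 : 0 <= b by rewrite mulr_ge0 ?enorm_ge0 // invr_ge0 ltW.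
have low x : (phi xs + (qpen t y xs + (k * enorm (x - xs) ^+ 2 - b * enorm (x - xs)))%:E
    <= phi x + (qpen t y x)%:E)%E.
  apply: le_trans (prox_growth y x pm t0).
  rewrite leeD2l // lee_fin lerD2l -/k enorm_sqr lerD2l lerN2 /b -mulrA.
  rewrite ler_pM2l ?invr_gt0 //; apply: le_trans (inner_le_enorm _ _) _.
  by rewrite mulrC.
(* Beyond distance [b / k] the lower bound [k s^2 - b s] is nonnegative, so [xs] does at least as
   well and minimising over a compact ball suffices. *)
pose d := b / k; have d0 : 0 <= d by rewrite divr_ge0 // ltW.
pose K : set E := [set x | `|xs - x| <= d].
have cq : continuous (qpen t y).
  move=> x; have : Ck 0 (fun x : E => (2 * t)^-1 * inner (x - y) (x - y)) setT.
    apply: Ck_mul; [exact: openT|exact: Ck_cst|].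
    by apply: Ck_inner; [exact: openT| |]; apply: Ck_add;
      do ?[exact: openT|exact: Ck_id|exact: Ck_cst].
  by move=> /(_ x I).
have [x Kx xmin] : exists2 x, K x &
    forall z, K z -> (phi x + (qpen t y x)%:E <= phi z + (qpen t y z)%:E)%E.
  (* The last term is the minimum of [k s^2 - b s] over [s]. *)
  apply: (@lsc_compact_min _ _ _ _ _ xs
    (fine (phi xs) + qpen t y xs - b ^+ 2 / (4 * k)) (pm_lsc pm) cq).
  - exact: norm_compact.
  - by rewrite /K /= subrr normr0.
  - exact: fx.
  move=> x _; apply: le_trans (low x); rewrite -{2}(fineK fx) -EFinD lee_fin.
  rewrite -addrA lerD2l lerD2l -subr_ge0.
  rewrite (_ : _ - _ = k * (enorm (x - xs) - b / (2 * k)) ^+ 2).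
    by rewrite mulr_ge0 ?sqr_ge0 // ltW.
  by field; rewrite gt_eqF.
exists x => z; have [zK|zK] := leP `|xs - z| d; first exact: xmin.
have Kxs : K xs by rewrite /K /= subrr normr0.
apply: le_trans (xmin _ Kxs) _; apply: le_trans (low z).
rewrite leeD2l // lee_fin lerDl expr2 mulrA -mulrBl mulr_ge0 ?enorm_ge0 //.
rewrite subr_ge0 mulrC -ler_pdivrMr // -/d.
by apply: ltW; apply: lt_le_trans zK _; rewrite distrC; exact: norm_le_enorm.
Qed.

(** Comparison with [xs] in [prox_growth], then Cauchy-Schwarz. The same constant later bounds the
    difference quotients of the proximal map. *)
Lemma prox_near phi xs v eps r t y x : prox_model phi xs v eps r -> 0 < t < r^-1 ->
  prox t phi y x ->
  enorm (x - xs) <= ((t^-1 - r) / 2 * t)^-1 * enorm (y - (xs + t *: v)).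
Proof.
move=> pm /andP[t0 tr] px; have fx := pm_fin pm.
have rt : r < t^-1 by rewrite -[r]invrK ltf_pV2 ?posrE ?invr_gt0 //; exact: pm_r pm.
have := le_trans (prox_growth y x pm t0) (px xs).
rewrite -(fineK fx) -!EFinD lee_fin.
set k := (t^-1 - r) / 2; have k0 : 0 < k by rewrite /k; lra.
have [->|s0] := eqVneq (enorm (x - xs)) 0.
  by rewrite mulr_ge0 ?enorm_ge0 // invr_ge0 mulr_ge0 // ltW.
have sp : 0 < enorm (x - xs) by rewrite lt_neqAle eq_sym s0 enorm_ge0.
move=> h.
have h2 : k * inner (x - xs) (x - xs) <= t^-1 * inner (x - xs) (y - (xs + t *: v)) by lra.
have h3 : k * enorm (x - xs) ^+ 2 <=
    t^-1 * (enorm (x - xs) * enorm (y - (xs + t *: v))).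
  rewrite enorm_sqr; apply: le_trans h2 _; rewrite ler_pM2l ?invr_gt0 //.
  exact: inner_le_enorm.
rewrite invfM -mulrA ler_pdivlMl // -(ler_pM2l sp); move: h3.
lra.
Qed.

(** Supplies all the localisations that [pm_reg] asks for. The bound on [phi x] comes from the
    optimality of [x] against [xs], not from continuity. *)
Lemma prox_close phi xs v eps r t e : prox_model phi xs v eps r -> 0 < t < r^-1 ->
  0 < e -> exists2 d : R, 0 < d & forall y x, enorm (y - (xs + t *: v)) < d ->
    prox t phi y x ->
    [/\ rsubdiff phi x (t^-1 *: (y - x)), enorm (t^-1 *: (y - x) - v) < e,
        enorm (x - xs) < e & (phi x < phi xs + e%:E)%E].
Proof.
move=> pm ht e0; have /andP[t0 tr] := ht; have fx := pm_fin pm.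
have rt : r < t^-1 by rewrite -[r]invrK ltf_pV2 ?posrE ?invr_gt0 //; exact: pm_r pm.
pose C := ((t^-1 - r) / 2 * t)^-1.
have C0 : 0 < C by rewrite invr_gt0 mulr_gt0 //; lra.
have ti : 0 < t^-1 by rewrite invr_gt0.
(* One summand per estimate: subgradient, point and value; the leading [1] makes [A] positive. *)
pose A := 1 + t^-1 * (1 + C) + C + C * (enorm v + t^-1).
have A1 : 0 <= t^-1 * (1 + C) by rewrite mulr_ge0 //; lra.
have A2 : 0 <= C * (enorm v + t^-1).
  by rewrite mulr_ge0 ?addr_ge0 ?enorm_ge0 // ltW.
have A0 : 0 < A by rewrite /A; lra.
exists (Num.min 1 (e / A)); first by rewrite lt_min ltr01 divr_gt0.
move=> y x; rewrite lt_min ltr_pdivlMr // => /andP[d1 dA] px.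
have s := prox_near pm ht px; rewrite -/C in s.
have d0 : 0 <= enorm (y - (xs + t *: v)) by exact: enorm_ge0.
have s0 : 0 <= enorm (x - xs) by exact: enorm_ge0.
rewrite /A !mulrDr mulr1 in dA.
have D1 : 0 <= enorm (y - (xs + t *: v)) * (t^-1 * (1 + C)) by exact: mulr_ge0.
have D2 : 0 <= enorm (y - (xs + t *: v)) * (C * (enorm v + t^-1)) by exact: mulr_ge0.
rewrite !mulrDr !mulr1 in D1; rewrite !mulrDr in D2.
split.
- by apply: prox_subgrad => //; [exact: pm_proper pm|exists xs].
- have -> : t^-1 *: (y - x) - v = t^-1 *: ((y - (xs + t *: v)) - (x - xs)).
    by apply/rowP => i; rewrite !mxE; field; rewrite gt_eqF.
  rewrite enormZ gtr0_norm //.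
  apply: le_lt_trans (_ : t^-1 * (enorm (y - (xs + t *: v)) + enorm (x - xs)) < e).
    rewrite ler_pM2l //; apply: le_trans (enormD _ _) _.
    by rewrite enormN.
  apply: le_lt_trans (_ : t^-1 * (enorm (y - (xs + t *: v))
      + C * enorm (y - (xs + t *: v))) < e); first by rewrite ler_pM2l // lerD2l.
  rewrite mulrDr; lra.
- lra.
have := px xs; have := pm_proper pm x; case: (phi x) => [p| |] // _; last first.
  by rewrite -(fineK fx) addye.
rewrite -(fineK fx) -!EFinD lee_fin lte_fin (qpen_expand y x xs v t0).
have := inner_ge0 (x - xs); have := inner_le_enorm v (x - xs).
have := inner_le_enorm (x - xs) (y - (xs + t *: v)).
set P := inner (x - xs) _; set Q := inner v _; set S := inner _ _.
move=> hP hQ hS h.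
have S2 : 0 <= (2 * t)^-1 * S by rewrite mulr_ge0 // invr_ge0 mulr_ge0 // ltW.
have P2 : t^-1 * P <= t^-1 * enorm (x - xs).
  rewrite ler_pM2l //; apply: le_trans hP _; rewrite -[leRHS]mulr1.
  by rewrite ler_wpM2l // ltW.
have s3 : enorm (x - xs) * (enorm v + t^-1) <=
    C * enorm (y - (xs + t *: v)) * (enorm v + t^-1).
  by rewrite ler_wpM2r // addr_ge0 ?enorm_ge0 // ltW.
lra.
Qed.

(** Hypomonotonicity: the sum of the two prox-regularity inequalities, each tested at the other
    point. *)
Lemma prox_model_monotone phi xs v eps r x1 v1 x2 v2 : prox_model phi xs v eps r ->
  lsubdiff phi x1 v1 -> enorm (v1 - v) < eps -> enorm (x1 - xs) < eps ->
  (phi x1 < phi xs + eps%:E)%E ->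
  lsubdiff phi x2 v2 -> enorm (v2 - v) < eps -> enorm (x2 - xs) < eps ->
  (phi x2 < phi xs + eps%:E)%E ->
  - (r * inner (x1 - x2) (x1 - x2)) <= inner (v1 - v2) (x1 - x2).
Proof.
move=> pm a1 a2 a3 a4 b1 b2 b3 b4.
have := pm_reg pm a1 a2 a3 a4 b3; have := pm_reg pm b1 b2 b3 b4 a3.
have [f1 _] := a1; have [f2 _] := b1.
rewrite -(fineK f1) -(fineK f2) -!EFinD !lee_fin.
rewrite -(opprB x1 x2) !innerNr !innerNl opprK.
rewrite (innerDl v1) (innerNl v2); lra.
Qed.

(** Two proximal points of the same [y] have subgradients differing by [- t^-1] times their
    difference, which hypomonotonicity forbids when [r < t^-1]. *)
Lemma prox_map_exists phi xs v eps r t : prox_model phi xs v eps r -> 0 < t < r^-1 ->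
  exists2 P : E -> E, P (xs + t *: v) = xs &
  exists2 d : R, 0 < d & forall y, enorm (y - (xs + t *: v)) < d ->
    prox t phi y = [set P y].
Proof.
move=> pm ht; have /andP[t0 tr] := ht.
have rt : r < t^-1 by rewrite -[r]invrK ltf_pV2 ?posrE ?invr_gt0 //; exact: pm_r pm.
pose P y := get (prox t phi y).
have PP y : prox t phi y (P y).
  by apply: getPex; have [x px] := prox_exists y pm ht; exists x.
exists P.
  apply/eqP; rewrite -subr_eq0; apply/eqP/inner_eq0; rewrite -enorm_sqr.
  have := prox_near pm ht (PP (xs + t *: v)).
  rewrite subrr [X in _ * X]/enorm inner0l sqrtr0 mulr0 => h.
  by have := enorm_ge0 (P (xs + t *: v) - xs); nra.
have [d d0 dP] := prox_close pm ht (pm_eps pm).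
exists d => // y yd; apply/seteqP; split=> [x px|_ -> //].
have [a1 a2 a3 a4] := dP _ _ yd px; have [b1 b2 b3 b4] := dP _ _ yd (PP y).
apply/eqP; rewrite -subr_eq0; apply/eqP/inner_eq0.
have := prox_model_monotone pm (rsubdiff_lsubdiff a1) a2 a3 a4
  (rsubdiff_lsubdiff b1) b2 b3 b4.
have -> : t^-1 *: (y - x) - t^-1 *: (y - P y) = - t^-1 *: (x - P y).
  by apply/rowP => i; rewrite !mxE; ring.
rewrite innerZl; set S := inner _ _ => h.
have : (t^-1 - r) * S <= 0 by lra.
by rewrite pmulr_rle0 //; lra.
Qed.

End LocalProx.

(** * Second-order epi-differentiability *)

Section SecondOrder.
Set Implicit Arguments. Unset Strict Implicit.
Context {R : realType} {n : nat}.
Local Notation E := 'rV[R]_n.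
Implicit Types (phi : E -> \bar R) (x y v xs : E) (t r eps : R).

(** The selector satisfies only [k <= s k], not strict monotonicity; this already preserves limits
    at infinity. *)
Lemma bounded_subsequence (u : nat -> E) (B : R) : (forall k, `|u k| <= B) ->
  exists (p : E) (s : nat -> nat), (forall k, (k <= s k)%N) /\ u \o s @ \oo --> p.
Proof.
move=> uB.
have cK : compact [set x : E | `|0 - x| <= B] by exact: norm_compact.
have FK : (u @ \oo) [set x : E | `|0 - x| <= B].
  by exists 0%N => // k _ /=; rewrite sub0r normrN.
have [p [_ cp]] := cK _ _ FK.
have ex k : exists j, (k <= j)%N /\ `|p - u j| < k.+1%:R^-1.
  have FA : (u @ \oo) (u @` [set j | (k <= j)%N]).
    by exists k => // j kj; exists j.
  have nB : nbhs p (ball p (k.+1%:R^-1 : R)) by apply: nbhsx_ballx; rewrite invr_gt0.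
  have [_ [[j kj <-] Bj]] := cp _ _ FA nB.
  by exists j; split => //; move: Bj; rewrite -ball_normE.
have /choice[s sP] := ex.
exists p, s; split=> [k|]; first by case: (sP k).
apply/cvgrPdist_lt => e e0; near=> k.
apply: lt_le_trans (sP k).2 _; apply: ltW.
near: k; exact: near_infty_natSinv_lt (PosNum e0).
Unshelve. all: by end_near. Qed.

Lemma subseq_cvg (T : topologicalType) (u : nat -> T) (s : nat -> nat) (l : T) :
  (forall k, (k <= s k)%N) -> u @ \oo --> l -> u \o s @ \oo --> l.
Proof.
move=> hs ul; apply: cvg_comp ul.
move=> A [N _ NA]; exists N => // k Nk; apply: NA => /=.
exact: leq_trans Nk (hs k).
Qed.

Lemma cvg_inner (p q : nat -> E) (p0 q0 : E) : p @ \oo --> p0 -> q @ \oo --> q0 ->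
  (fun k => inner (p k) (q k)) @ \oo --> inner p0 q0.
Proof.
move=> pc qc; rewrite innerE; under eq_fun do rewrite innerE.
have cc (j : 'I_n) (z : nat -> E) (z0 : E) :
    z @ \oo --> z0 -> (fun k => z k 0 j) @ \oo --> z0 0 j.
  by move=> zc; exact: (cvg_comp _ _ zc (@coord_continuous _ _ _ 0 j z0)).
elim: (index_enum _) => [|j s IH].
  by rewrite big_nil; under eq_fun do rewrite big_nil; exact: cvg_cst.
rewrite big_cons.
rewrite (_ : (fun k => _) = (fun k => p k 0 j * q k 0 j + \sum_(j <- s) p k 0 j * q k 0 j)).
  by apply: cvgD => //; apply: cvgM; exact: cc.
by apply/funext => k; rewrite big_cons.
Qed.

Lemma limn_esup_lt_near (u : nat -> \bar R) (a : \bar R) : (limn_esup u < a)%E ->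
  \forall k \near \oo, (u k < a)%E.
Proof.
move=> /ereal_inf_lt[_ [V FV <-]] h; apply: filterS FV => k Vk.
by apply: le_lt_trans h; apply: ereal_sup_ubound; exists k.
Qed.

Lemma limn_einf_le_near (u : nat -> \bar R) (a : \bar R) :
  (\forall k \near \oo, (u k <= a)%E) -> (limn_einf u <= a)%E.
Proof.
move=> ua; rewrite /limn_einf leeNl; apply: le_ereal_inf_tmp => _ [V FV <-].
have [k [Vk uk]] := filter_ex (filterI FV ua).
apply: le_trans (_ : (- u k <= _)%E); first by rewrite leeN2.
by apply: ereal_sup_ubound; exists k.
Qed.

Lemma sdq_fin phi x v (tau q a : R) u : phi x = a%:E -> phi (x + tau *: u) = q%:E ->
  sdq phi x v tau u = ((q - a - tau * inner v u) * (tau ^+ 2 / 2)^-1)%:E.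
Proof. by move=> ea eq; rewrite /sdq ea eq -!EFinD -EFinM. Qed.

Lemma sdq_pinfty phi x v (tau a : R) u : 0 < tau -> phi x = a%:E ->
  phi (x + tau *: u) = +oo%E -> sdq phi x v tau u = +oo%E.
Proof.
move=> tau0 ea eq; rewrite /sdq ea eq !addye // gt0_mulye //.
by rewrite lte_fin invr_gt0 divr_gt0 // exprn_gt0.
Qed.

Lemma sdq_ge phi xs v eps r (tau : R) u : prox_model phi xs v eps r -> 0 < tau ->
  ((- (r * inner u u))%:E <= sdq phi xs v tau u)%E.
Proof.
move=> pm tau0; have [a0 a] : exists a0 : R, phi xs = a0%:E.
  by exists (fine (phi xs)); rewrite fineK //; exact: pm_fin pm.
have := pm_minorant pm (xs + tau *: u); have := pm_proper pm (xs + tau *: u).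
case e : (phi (xs + tau *: u)) => [q| |] // _; last first.
  by move=> _; rewrite (sdq_pinfty v tau0 a e) leey.
rewrite (sdq_fin v a e) a -EFinD !lee_fin [xs + _ - xs]addrAC subrr add0r !innerlin => h.
rewrite ler_pdivlMr ?divr_gt0 ?exprn_gt0 //; lra.
Qed.

(** The proximal objective at [xs + tau *: u], divided by [tau ^+ 2 / 2], is [sdq] plus
    [t^-1 * (inner u u - 2 * inner u d)] up to a constant independent of [u]. Optimality is rescaled
    accordingly. *)
Lemma prox_sdq_min phi xs v eps r t (tau : R) d u w : prox_model phi xs v eps r ->
  0 < t -> 0 < tau -> prox t phi (xs + t *: v + tau *: d) (xs + tau *: u) ->
  (sdq phi xs v tau u <= sdq phi xs v tau w +
    (t^-1 * (inner w w - 2 * inner w d) - t^-1 * (inner u u - 2 * inner u d))%:E)%E.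
Proof.
move=> pm t0 tau0 px; have [a0 a] : exists a0 : R, phi xs = a0%:E.
  by exists (fine (phi xs)); rewrite fineK //; exact: pm_fin pm.
have [fx _] : rsubdiff phi (xs + tau *: u)
    (t^-1 *: (xs + t *: v + tau *: d - (xs + tau *: u))).
  by apply: prox_subgrad => //; [exact: pm_proper pm|exists xs; exact: pm_fin pm].
have q := esym (fineK fx); rewrite (sdq_fin v a q).
have := px (xs + tau *: w); have := pm_proper pm (xs + tau *: w).
case e : (phi (xs + tau *: w)) => [p| |] // _; last first.
  by move=> _; rewrite (sdq_pinfty v tau0 a e) addye // leey.
rewrite (sdq_fin v a e) q -!EFinD !lee_fin.
rewrite (qpen_expand _ (xs + tau *: u) xs v t0) (qpen_expand _ (xs + tau *: w) xs v t0).
have -> : xs + t *: v + tau *: d - (xs + t *: v) = tau *: d by rewrite addrAC subrr add0r.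
have sub z : xs + tau *: z - xs = tau *: z by rewrite addrAC subrr add0r.
rewrite !sub !innerlin.
set A := fine _; set q0 := qpen _ _ _ => h.
have t2 : 0 <= (tau ^+ 2 / 2)^-1 by rewrite invr_ge0 divr_ge0 ?sqr_ge0.
have red (b : R) z : (b + (q0 + (2 * t)^-1 * (tau * (tau * inner z z))
     - tau * inner v z - t^-1 * (tau * (tau * inner z d)))) * (tau ^+ 2 / 2)^-1 =
   (b - a0 - tau * inner v z) * (tau ^+ 2 / 2)^-1 + (a0 + q0) * (tau ^+ 2 / 2)^-1
     + t^-1 * (inner z z - 2 * inner z d).
  by field; rewrite !gt_eqF.
by have := ler_wpM2r t2 h; rewrite !red /=; lra.
Qed.

(** The two halves of epi-convergence: the liminf inequality along the quotients [u], and a recovery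
    sequence for the competitor [w]. Thus [ul] is optimal in the limit problem. *)
Lemma prox_epi_limit phi xs v eps r t (tau : nat -> R) (d u : nat -> E) dl ul w :
  prox_model phi xs v eps r -> 0 < t -> twice_epi_diff phi xs v ->
  (forall k, 0 < tau k) -> tau @ \oo --> 0 -> d @ \oo --> dl -> u @ \oo --> ul ->
  (\forall k \near \oo, prox t phi (xs + t *: v + tau k *: d k) (xs + tau k *: u k)) ->
  forall m : R, subderiv2 phi xs v w = m%:E ->
  (subderiv2 phi xs v ul <= (m + t^-1 * (inner w w - 2 * inner w dl)
     - t^-1 * (inner ul ul - 2 * inner ul dl))%:E)%E.
Proof.
move=> pm t0 [_ epi] tau0 tauc dc uc px m mE.
have [lo _] := epi tau tau0 tauc ul; have [_ [wk wc hw]] := epi tau tau0 tauc w.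
apply: le_trans (lo _ uc) _.
pose G (x y : E) := t^-1 * (inner x x - 2 * inner x y).
have Gc (x y : nat -> E) (a b : E) : x @ \oo --> a -> y @ \oo --> b ->
    (fun k => G (x k) (y k)) @ \oo --> G a b.
  move=> xa yb.
  by apply: cvgMl_tmp; apply: cvgB; [exact: cvg_inner|apply: cvgMl_tmp; exact: cvg_inner].
apply/lee_addgt0Pr => e e0.
apply: limn_einf_le_near.
have hw2 : \forall k \near \oo, (sdq phi xs v (tau k) (wk k) < (m + e / 2)%:E)%E.
  apply: limn_esup_lt_near; apply: le_lt_trans hw _; rewrite mE lte_fin; lra.
have e20 : 0 < e / 2 by lra.
have /cvgrPdist_lt/(_ _ e20) hG :
    (fun k => G (wk k) (d k) - G (u k) (d k)) @ \oo --> G w dl - G ul dl.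
  by apply: cvgB; exact: Gc.
near=> k.
have pk : prox t phi (xs + t *: v + tau k *: d k) (xs + tau k *: u k) by near: k.
apply: le_trans (prox_sdq_min (wk k) pm t0 (tau0 k) pk) _.
have : (sdq phi xs v (tau k) (wk k) < (m + e / 2)%:E)%E by near: k.
have : `|G w dl - G ul dl - (G (wk k) (d k) - G (u k) (d k))| < e / 2 by near: k.
rewrite /G -EFinD; case: (sdq _ _ _ _ _) => [q| |] //; last by rewrite leNye.
rewrite -EFinD lte_fin lee_fin ltr_norml => /andP[h1 h2] h3; lra.
Unshelve. all: by end_near. Qed.

End SecondOrder.

(** * Differentiability of the proximal map from second-order data *)

Section ProxDifferentiable.
Set Implicit Arguments. Unset Strict Implicit.
Context {R : realType} {n : nat}.
Local Notation E := 'rV[R]_n.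
Implicit Types (phi : E -> \bar R) (x y v xs : E) (t r eps : R).

Lemma quadratic_nonneg_linear0 (A B : R) :
  (forall e : R, 0 <= e * A + e ^+ 2 * B) -> A = 0.
Proof.
move=> h; apply/eqP/negPn/negP => A0.
have A2 : 0 < A ^+ 2 by rewrite exprn_even_gt0.
have B1 : 0 < 1 + `|B| by have := normr_ge0 B; lra.
have := h (- (A / (1 + `|B|))).
have -> : - (A / (1 + `|B|)) * A + (- (A / (1 + `|B|))) ^+ 2 * B =
    (A ^+ 2 / (1 + `|B|) ^+ 2) * (B - (1 + `|B|)) by field; rewrite gt_eqF.
rewrite pmulr_rge0; last by rewrite divr_gt0 // exprn_gt0.
have := ler_norm B; lra.
Qed.

Definition harmonic_scaled (c : R) : nat -> R := fun k => c * k.+1%:R^-1.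

Lemma harmonic_scaled_gt0 c k : 0 < c -> 0 < harmonic_scaled c k.
Proof. by move=> c0; rewrite mulr_gt0 // invr_gt0. Qed.

Lemma harmonic_scaled_le c k : 0 < c -> harmonic_scaled c k <= c.
Proof. by move=> c0; rewrite ger_pMr // invf_le1 // ler1n. Qed.

Lemma harmonic_scaled_cvg c : harmonic_scaled c @ \oo --> 0.
Proof.
by rewrite -(mulr0 c); apply: cvgMl_tmp; exact: cvg_harmonic.
Qed.

(** The uniform bound [sdq_ge] passes to the limit along a recovery sequence. It makes the limit
    quadratic plus the penalty positive definite on the subspace. *)
Lemma subderiv2_lower phi xs v eps r w (m : R) : prox_model phi xs v eps r ->
  twice_epi_diff phi xs v -> subderiv2 phi xs v w = m%:E -> - (r * inner w w) <= m.
Proof.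
move=> pm [_ epi] mE; rewrite leNgt; apply/negP => lt.
have h1 := @harmonic_scaled_gt0 1.
have [_ [wk wc hw]] := epi (harmonic_scaled 1) (fun k => h1 k ltr01)
  (@harmonic_scaled_cvg 1) w.
pose e := (- (r * inner w w) - m) / 2; have e0 : 0 < e by rewrite /e; lra.
have hn : \forall k \near \oo, (sdq phi xs v (harmonic_scaled 1 k) (wk k) < (m + e)%:E)%E.
  by apply: limn_esup_lt_near; apply: le_lt_trans hw _; rewrite mE lte_fin; lra.
have : (fun k => - (r * inner (wk k) (wk k))) @ \oo --> - (r * inner w w).
  by apply: cvgN; apply: cvgMl_tmp; exact: cvg_inner.
move=> /cvgrPdist_lt /(_ e e0) hc.
have [k [k1 k2]] := filter_ex (filterI hn hc).
have := le_lt_trans (sdq_ge (wk k) pm (h1 k ltr01)) k1; rewrite lte_fin.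
by have := ler_norm (- (r * inner w w) - - (r * inner (wk k) (wk k))); rewrite /e in k2 *; lra.
Qed.

(** Every family of difference quotients has a subsequence converging to a solution of [sol]. Since
    [sol] is a linear relation with unique solutions, its solution map [L] is linear, and it must be
    the differential. *)
Lemma prox_differentiable phi xs v eps r t : prox_model phi xs v eps r ->
  0 < t < r^-1 -> twice_epi_diff phi xs v -> gen_quadratic_subderiv2 phi xs v ->
  setmap_diff_at (prox t phi) (xs + t *: v).
Proof.
move=> pm ht epi [M [S [[S0 linS] DE]]]; have /andP[t0 tr] := ht.
have rt : r < t^-1 by rewrite -[r]invrK ltf_pV2 ?posrE ?invr_gt0 //; exact: pm_r pm.
have [P P0 [d0 d00 PP]] := prox_map_exists pm ht.
set y0 := xs + t *: v in P0 PP *.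
pose C := ((t^-1 - r) / 2 * t)^-1.
have C0 : 0 < C by rewrite invr_gt0 mulr_gt0 //; lra.
have PC h : enorm h < d0 -> `|P (y0 + h) - xs| <= C * (n.+1%:R * `|h|).
  move=> hd; have yd : enorm (y0 + h - y0) < d0 by rewrite [y0 + h - y0]addrAC subrr add0r.
  have px : prox t phi (y0 + h) (P (y0 + h)) by rewrite (PP _ yd).
  apply: le_trans (norm_le_enorm _) _; apply: le_trans (prox_near pm ht px) _.
  rewrite -/C ler_pM2l // -/y0 [y0 + h - y0]addrAC subrr add0r; exact: enorm_le_norm.
(* Symmetrised because the matrix [M] is not assumed symmetric. *)
pose b (u s : E) := (inner u (s *m M^T) + inner s (u *m M^T)) / 2 + t^-1 * inner u s.
(* [sol d u] is the first-order condition for [u] to minimise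
   [subderiv2 phi xs v u + |u - d|^2 / t], linear in the pair [(d, u)]. *)
pose sol (d u : E) := S u /\ forall s, S s -> b u s = t^-1 * inner d s.
have DS u : S u -> subderiv2 phi xs v u = (inner u (u *m M^T))%:E.
  by move=> Su; rewrite DE; case: asboolP.
have limit (tau : nat -> R) (d : nat -> E) (B : R) :
    (forall k, 0 < tau k) -> tau @ \oo --> 0 -> (forall k, `|d k| <= B) ->
    (forall k, enorm (tau k *: d k) < d0) ->
    exists (s : nat -> nat) (dl ul : E), [/\ d \o s @ \oo --> dl,
      (fun k => (tau (s k))^-1 *: (P (y0 + tau (s k) *: d (s k)) - xs)) @ \oo --> ul
      & sol dl ul].
  move=> tau0 tauc dB td.
  have [dl [s1 [hs1 dc]]] := bounded_subsequence dB.
  pose u k := (tau k)^-1 *: (P (y0 + tau k *: d k) - xs).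
  have uB k : `|u k| <= C * n.+1%:R * B.
    rewrite /u normrZ gtr0_norm ?invr_gt0 // ler_pdivrMl //.
    apply: le_trans (PC _ (td k)) _; rewrite normrZ gtr0_norm //.
    rewrite [leRHS]mulrCA -!mulrA ler_pM2l // ler_pM2l // ler_pM2l //.
  have [ul [s2 [hs2 uc]]] := @bounded_subsequence _ _ (u \o s1) _ (fun k => uB (s1 k)).
  exists (s1 \o s2), dl, ul.
  have dc' : d \o (s1 \o s2) @ \oo --> dl by exact: (subseq_cvg hs2 dc).
  split=> //.
  have hs k : (k <= (s1 \o s2) k)%N by exact: leq_trans (hs2 k) (hs1 _).
  have px : \forall k \near \oo, prox t phi
      (xs + t *: v + (tau \o (s1 \o s2)) k *: (d \o (s1 \o s2)) k)
      (xs + (tau \o (s1 \o s2)) k *: (u \o (s1 \o s2)) k).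
    apply: nearW => k /=; rewrite /u scalerA mulfV ?gt_eqF // scale1r subrKC.
    by rewrite -/y0 PP // [y0 + _ - y0]addrAC subrr add0r.
  have key := prox_epi_limit pm t0 epi (fun k => tau0 _) (subseq_cvg hs tauc) dc' uc px.
  (* Off [S] the subderivative is infinite, whereas comparison with the competitor [0] bounds it. *)
  have Sul : S ul.
    apply: contrapT => nS.
    have := key _ _ (DS _ S0); rewrite DE; case: asboolP => [/nS//|_].
    by rewrite leye_eq.
  split=> // s Ss.
  have Q e : 0 <= e * (2 * b ul s - 2 * t^-1 * inner dl s)
      + e ^+ 2 * (inner s (s *m M^T) + t^-1 * inner s s).
    have Sw : S (ul + e *: s) by rewrite -[ul]scale1r; exact: linS.
    have := key _ _ (DS _ Sw); rewrite (DS _ Sul) lee_fin.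
    rewrite mulmxDl -scalemxAl !innerlin (innerC s ul) (innerC ul dl) (innerC s dl) /b.
    lra.
  by have := quadratic_nonneg_linear0 Q; lra.
have bDl a u u' s : b (a *: u + u') s = a * b u s + b u' s.
  by rewrite /b mulmxDl -scalemxAl !innerlin; lra.
(* For the difference [w] of two solutions [b w w = 0], while [subderiv2_lower] gives
   [b w w >= (t^-1 - r) * inner w w]. *)
have sol_uniq d u u' : sol d u -> sol d u' -> u = u'.
  move=> [Su bu] [Su' bu']; apply/eqP; rewrite eq_sym -subr_eq0; apply/eqP/inner_eq0.
  pose w := -1 *: u + u'.
  have wE : w = u' - u by rewrite /w scaleN1r addrC.
  have Sw : S w by rewrite /w -[u']scale1r; exact: linS.
  rewrite -wE.
  have : b w w = 0 by rewrite {1}/w bDl bu // bu' // mulN1r addNr.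
  have := subderiv2_lower pm epi (DS _ Sw); rewrite /b => h1 h2.
  have : (t^-1 - r) * inner w w <= 0 by lra.
  by rewrite pmulr_rle0 //; lra.
(* A constant direction with shrinking steps: the proximal points themselves produce a solution. The
   constant [c] keeps all steps where the map is single-valued. *)
have sol_ex d : exists u, sol d u.
  have B0 : 0 < `|d| + 1 by have := normr_ge0 d; lra.
  pose c := d0 / (n.+1%:R * (`|d| + 1)).
  have c0 : 0 < c by rewrite divr_gt0 // mulr_gt0.
  have [||//||s [dl [ul [dc _ sl]]]] := limit (harmonic_scaled c) (fun=> d) `|d|.
  - by move=> k; exact: harmonic_scaled_gt0.
  - exact: harmonic_scaled_cvg.
  - move=> k; apply: le_lt_trans (enorm_le_norm _) _.
    rewrite normrZ gtr0_norm ?harmonic_scaled_gt0 //.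
    have : harmonic_scaled c k * `|d| <= c * `|d|.
      by rewrite ler_wpM2r // harmonic_scaled_le.
    have : n.+1%:R * (c * (`|d| + 1)) = d0 by rewrite mulrCA /c divfK // gt_eqF // mulr_gt0.
    rewrite mulrDr mulr1 => E1 E2.
    have : n.+1%:R * (harmonic_scaled c k * `|d|) <= n.+1%:R * (c * `|d|) by rewrite ler_pM2l.
    have : 0 < n.+1%:R * c by rewrite mulr_gt0.
    lra.
  have <- : dl = d.
    by apply/esym; apply: (cvg_unique _ _ dc) => //; exact: cvg_cst.
  by exists ul.
pose L d : E := get (sol d).
have LP d : sol d (L d) by apply: getPex; have [u] := sol_ex d; exists u.
have linL : linear L.
  move=> a d d'; apply: (@sol_uniq (a *: d + d')); first exact: LP.
  have [S1 b1] := LP d; have [S2 b2] := LP d'.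
  split=> [|s Ss]; first by rewrite -[L d']scale1r; exact: linS.
  by rewrite bDl b1 // b2 // !innerlin; lra.
pose LL : {linear E -> E} := HB.pack L (GRing.isLinear.Build _ _ _ _ _ linL).
have cL : continuous LL by exact: linear_rV_continuous.
exists [set y | enorm (y - y0) < d0], P; split.
- exact: open_enorm_ball.
- by rewrite /= subrr /enorm inner0l sqrtr0.
- by move=> z; exact: PP.
suff : is_diff y0 P LL by case.
(* Were the estimate false, increments [h k] tending to zero would violate it; their unit directions
   and quotients subconverge to a pair in [sol], which forces the error back to zero. *)
apply: is_diff_eps => // e e0; apply: contrapT => nh.
have bad (d : R) : 0 < d -> exists h, `|h| < d /\ e * `|h| < `|P (y0 + h) - P y0 - LL h|.
  move=> dp; apply: contrapT => no; apply: nh; apply/near_normP; exists d => // h.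
  rewrite subr0 => hd; rewrite leNgt; apply/negP => lt; apply: no; by exists h.
pose c := d0 / n.+1%:R; have c0 : 0 < c by rewrite divr_gt0.
have /choice[h hP] := fun k => bad _ (harmonic_scaled_gt0 k c0).
pose tau k := `|h k|.
have tau0 k : 0 < tau k.
  rewrite /tau normr_gt0; apply/eqP => h0; have [_] := hP k.
  by rewrite h0 addr0 subrr linear0 subr0 normr0 mulr0 ltxx.
pose d k := (tau k)^-1 *: h k.
have td k : tau k *: d k = h k by rewrite /d scalerA mulfV ?scale1r // gt_eqF.
have [||k|k|s [dl [ul [dc uc [sl]]]]] := limit tau d 1.
- exact: tau0.
- apply/cvgrPdist_lt => e1 e10.
  have /cvgrPdist_lt/(_ _ e10) := harmonic_scaled_cvg c.
  apply: filterS => k; rewrite !sub0r !normrN => hk.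
  apply: le_lt_trans hk; rewrite /tau normr_id; apply: ltW.
  by apply: lt_le_trans (hP k).1 _; exact: ler_norm.
- by rewrite /d normrZ gtr0_norm ?invr_gt0 // mulVf // gt_eqF // tau0.
- rewrite td; apply: le_lt_trans (enorm_le_norm _) _.
  rewrite mulrC -ltr_pdivlMr //; apply: lt_le_trans (hP k).1 _.
  exact: harmonic_scaled_le.
move=> bl.
have uE : ul = L dl by apply: (@sol_uniq dl).
have Lc : (fun k => L (d (s k))) @ \oo --> L dl by exact: (cvg_comp _ _ dc (cL dl)).
have hB : (fun k => (tau (s k))^-1 *: (P (y0 + tau (s k) *: d (s k)) - xs) - L (d (s k)))
    @ \oo --> (0 : E).
  by rewrite -(subrr (L dl)) -{1}uE; exact: (cvgB uc Lc).
have /cvgrPdist_lt/(_ _ e0)/filter_ex[k] := hB.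
rewrite sub0r normrN /= => hk; have [_] := hP (s k).
have LZ : LL (tau (s k) *: d (s k)) = tau (s k) *: L (d (s k)) by rewrite linearZ.
rewrite P0 -(td (s k)) LZ.
set Z := P _ - xs in hk *.
have -> : Z - tau (s k) *: L (d (s k)) = tau (s k) *: ((tau (s k))^-1 *: Z - L (d (s k))).
  by rewrite scalerBr scalerA mulfV ?scale1r // gt_eqF.
have -> : `|tau (s k) *: d (s k)| = tau (s k) by rewrite td.
rewrite normrZ gtr0_norm // mulrC ltr_pM2l // => hk2.
by have := lt_trans hk hk2; rewrite ltxx.
Qed.

End ProxDifferentiable.

(** * Partial smoothness *)

Section Chart.
Set Implicit Arguments. Unset Strict Implicit.
Context {R : realType} {n : nat}.
Local Notation E := 'rV[R]_n.
Implicit Types (M : set E) (x u v w xs : E).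

Definition orth_projection (Pi : 'M[R]_n) : Prop := Pi^T = Pi /\ Pi *m Pi = Pi.

Lemma orth_projection_pythagoras Pi (a : E) : orth_projection Pi ->
  inner a a = inner (a *m Pi) (a *m Pi) + inner (a *m (1%:M - Pi)) (a *m (1%:M - Pi)).
Proof.
move=> [sP iP]; rewrite mulmxBr mulmx1.
have E1 : inner (a *m Pi) (a *m Pi) = inner a (a *m Pi).
  by rewrite inner_mulmx sP -mulmxA iP.
rewrite E1; rewrite (innerDl a) (innerDr a) innerNl !innerNr (innerDr (a *m Pi)) innerNr.
rewrite (innerC (a *m Pi) a) E1; lra.
Qed.

(** Surjectivity of the differential makes its Gram matrix invertible, which provides the explicit
    right inverse behind the normal projection. *)
Lemma gram_unit m (J : 'M[R]_(n, m)) : (forall w : 'rV[R]_m, exists v : E, v *m J = w) ->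
  J^T *m J \in unitmx.
Proof.
move=> sJ; apply: mulmx_inj_unit => w w0.
have z0 : w *m J^T = 0.
  apply: inner_eq0; rewrite /inner trmx_mul trmxK.
  by rewrite -mulmxA [X in w *m X]mulmxA [w *m _]mulmxA w0 mul0mx mxE.
have [v vJ] := sJ w; apply: inner_eq0.
rewrite /inner -{1}vJ -mulmxA -[J]trmxK -trmx_mul z0 trmx0 mulmx0 mxE //.
Qed.

(* [Psi] is the tangential projection of [x - xs] plus [Phi x] pushed into the
   normal space by a right inverse of the Jacobian, so that its differential at
   [xs] is the identity and [M] is flat in the coordinates [Psi]. *)
Lemma submanifold_straightening p M xs : Cp_submanifold p.+1 M -> M xs ->
  exists (Pi : 'M[R]_n) (U : set E) (Psi : E -> E),
  [/\ orth_projection Pi, open U, U xs & Ck p.+1 Psi U] /\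
  [/\ forall v, 'D_v Psi xs = v, Psi xs = 0,
      forall x, Psi x *m Pi = (x - xs) *m Pi &
      forall x, U x -> (M x <-> Psi x *m (1%:M - Pi) = 0)].
Proof.
move=> sm Mxs; have [m [U [Phi [oU Uxs CPhi sPhi MU]]]] := sm _ Mxs.
have dPhi : differentiable Phi xs by apply: Ck_diff CPhi _.
pose J := jacobian Phi xs.
have JE v : 'D_v Phi xs = v *m J by rewrite deriveEjacobian.
have uG : J^T *m J \in unitmx.
  by apply: gram_unit => w; have [v vw] := sPhi w; exists v; rewrite -JE.
pose B := invmx (J^T *m J).
have sB : B^T = B by rewrite /B trmx_inv trmx_mul trmxK.
(* The pseudo-inverse of the Jacobian; [J *m N] is the orthogonal projection whose kernel is the
   tangent space. *)
pose N := B *m J^T.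
have NJ : N *m J = 1%:M by rewrite /N -mulmxA mulVmx.
pose Q := J *m N.
have sQ : Q^T = Q by rewrite /Q /N !trmx_mul trmxK sB mulmxA.
have NQ : N *m Q = N by rewrite /Q mulmxA NJ mul1mx.
have QQ : Q *m Q = Q by rewrite {1}/Q -mulmxA NQ.
have Phi0 : Phi xs = 0 by apply/MU.
have PQ : (1%:M - Q) *m Q = 0 by rewrite mulmxBl mul1mx QQ subrr.
have NP : N *m (1%:M - Q) = 0 by rewrite mulmxBr mulmx1 NQ subrr.
have PP : (1%:M - Q) *m (1%:M - Q) = 1%:M - Q by rewrite mulmxBr mulmx1 PQ subr0.
have QE : 1%:M - (1%:M - Q) = Q by rewrite opprB addrC subrK.
have JN : J *m N = Q by [].
clearbody Q N.
exists (1%:M - Q), U, (fun x => (x - xs) *m (1%:M - Q) + Phi x *m N); split; split.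
- by split=> //; rewrite linearB /= trmx1 sQ.
- by [].
- by [].
- apply: Ck_add => //; last exact: Ck_mulmxc.
  apply: Ck_mulmxc => //; apply: Ck_add => //; first exact: Ck_id.
  exact: Ck_cst.
- move=> v.
  have dl k (A : 'M[R]_(k, n)) (z : 'rV[R]_k) : differentiable (mulmxr A : 'rV[R]_k -> E) z.
    by apply: linear_differentiable; exact: linear_rV_continuous.
  have -> : (fun x => (x - xs) *m (1%:M - Q) + Phi x *m N) =
      ((mulmxr (1%:M - Q) : E -> E) - cst (xs *m (1%:M - Q))) +
      ((mulmxr N : 'rV[R]_m -> E) \o Phi).
    by apply/funext => x; rewrite !fctE /= -mulmxBl.
  rewrite deriveD; [|apply: derivableB|]; last first.
  - by apply: diff_derivable; exact: differentiable_comp.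
  - exact: derivable_cst.
  - exact: diff_derivable.
  rewrite deriveB; [|exact: diff_derivable|exact: derivable_cst].
  rewrite derive_cst subr0 derive_comp // !derive_lin; [|exact: linear_rV_continuous..].
  by rewrite /= JE -mulmxA JN mulmxBr mulmx1 subrK.
- by rewrite subrr mul0mx Phi0 mul0mx addr0.
- by move=> x; rewrite mulmxDl -!mulmxA PP NP mulmx0 addr0.
move=> x Ux; rewrite (MU _ Ux) QE mulmxDl -!mulmxA PQ mulmx0 add0r NQ.
split=> [->|h]; first by rewrite mul0mx.
by rewrite -[Phi x]mulmx1 -NJ mulmxA h mul0mx.
Qed.

(* [chi] parametrises [M] near [xs] by the tangent component [u *m Pi] alone:
   keeping all of ['rV_n] as its domain avoids choosing a basis of the tangent
   space. *)
Record chart (p : nat) M xs (Pi : 'M[R]_n) (chi : E -> E) (d : R) : Prop := Chart {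
  chart_proj : orth_projection Pi;
  chart_gt0 : 0 < d;
  chart_Ck : Ck p chi (ball 0 d);
  chart0 : chi 0 = xs;
  chart_mem : forall u, ball 0 d u -> M (chi u);
  chart_coord : forall u, ball 0 d u -> (chi u - xs) *m Pi = u *m Pi;
  chart_Pi : forall u, chi (u *m Pi) = chi u;
  chart_onto : exists2 e : R, 0 < e &
    forall x, M x -> `|x - xs| < e -> chi (x - xs) = x;
  chart_normal : forall a, a *m Pi = 0 -> Defs.normal_space M xs a }.

(** [chi] is the local inverse of [Psi] restricted to the flat slice, the image of [Pi]. *)
Lemma submanifold_chart p M xs : Cp_submanifold p.+1 M -> M xs ->
  exists Pi chi d, chart p.+1 M xs Pi chi d.
Proof.
move=> sm Mxs.
have [Pi [U [Psi [[oP oU Uxs CPsi] [DPsi Psi0 PsiP MU]]]]] := submanifold_straightening sm Mxs.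
have [|A [W [Th [[oA Axs AU] [oW CTh ThP PsT]]]]] := inverse_function oU Uxs CPsi.
  by move=> v; rewrite DPsi.
have [sP iP] := oP.
have W0 : W 0 by rewrite -Psi0; exact: (ThP _ Axs).1.
have [C C0 CP] := mulmx_bound Pi.
have [dW dW0 hW] := (near_normP _ _).1 (open_nbhs_nbhs (conj oW W0)).
pose d := dW / C; have d0 : 0 < d by rewrite divr_gt0.
have WPi u : ball 0 d u -> W (u *m Pi).
  rewrite -ball_normE /= sub0r normrN => ud; apply: hW; rewrite subr0.
  by apply: le_lt_trans (CP _) _; rewrite mulrC -ltr_pdivlMr.
exists Pi, (fun u => Th (u *m Pi)), d; split=> //.
- apply: (@Ck_comp _ _ _ _ _ (fun u => u *m Pi) Th _ W) => //; first exact: ball_open.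
  by apply: Ck_mulmxc; [exact: ball_open|exact: Ck_id].
- by rewrite mul0mx -Psi0; exact: (ThP _ Axs).2.
- move=> u /WPi Wu; have [Au Pu] := PsT _ Wu.
  by apply/(MU _ (AU _ Au)); rewrite Pu -mulmxA mulmxBr mulmx1 iP subrr mulmx0.
- by move=> u /WPi Wu; have [Au Pu] := PsT _ Wu; rewrite -PsiP Pu -mulmxA iP.
- by move=> u; rewrite -mulmxA iP.
- have [e e0 he] := (near_normP _ _).1 (open_nbhs_nbhs (conj oA Axs)).
  exists e => // x Mx /he Ax; have /(MU _ (AU _ Ax)) := Mx.
  rewrite mulmxBr mulmx1 => /eqP; rewrite subr_eq0 => /eqP h.
  by rewrite -PsiP -h; exact: (ThP _ Ax).2.
move=> a aPi u [xk [tk [Mk tk0 xkc _ uc]]].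
(* Tangent vectors have no normal part: [Psi] agrees with [x - xs] to first order and has no normal
   part on [M], so the normal part of [xk - xs] is negligible against its length. *)
suff uPi : u *m (1%:M - Pi) = 0.
  have -> : u = u *m Pi.
    by apply/eqP; rewrite -subr_eq0; move: uPi; rewrite mulmxBr mulmx1 => ->.
  by rewrite innerC inner_mulmx sP aPi inner0r.
have [D D0 DP] := mulmx_bound (1%:M - Pi).
pose uk k := (tk k)^-1 *: (xk k - xs).
have small (e : R) : 0 < e -> \forall k \near \oo, `|uk k *m (1%:M - Pi)| <= D * (e * `|uk k|).
  move=> e0; have dPsi : differentiable Psi xs by apply: Ck_diff CPsi _.
  have [e1 e10 h1] := (near_normP _ _).1 (diff_eps dPsi e0).
  have nA : nbhs xs (A `&` [set x | `|xs - x| < e1]).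
    apply: filterI; first exact: open_nbhs_nbhs.
    by apply: (near_normP xs [set x | `|xs - x| < e1]).2; exists e1 => // y; rewrite distrC.
  have nk : \forall k \near \oo, A (xk k) /\ `|xs - xk k| < e1 := xkc _ nA.
  move: nk; apply: filterS => k [Ak nk].
  have := h1 (xk k - xs); rewrite subr0 distrC => /(_ nk).
  rewrite -deriveE // DPsi Psi0 subr0 subrKC => h.
  have /(MU _ (AU _ Ak)) Mz := Mk k.
  have -> : uk k *m (1%:M - Pi) = (tk k)^-1 *: (- ((Psi (xk k) - (xk k - xs)) *m (1%:M - Pi))).
    by rewrite [in RHS]mulmxBl Mz sub0r opprK -scalemxAl.
  rewrite normrZ normrN /uk normrZ gtr0_norm ?invr_gt0 //.
  rewrite [leRHS](_ : _ = (tk k)^-1 * (D * (e * `|xk k - xs|))); last by ring.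
  rewrite ler_pM2l ?invr_gt0 //; apply: le_trans (DP _) _.
  by rewrite ler_pM2l // (distrC (xk k) xs).
apply/eqP; rewrite -normr_eq0 eq_le normr_ge0 andbT; apply/ler_addgt0Pr => e e0; rewrite add0r.
pose e' := e / (4 * D * (`|u| + 1)).
have u1 : 0 < `|u| + 1 by have := normr_ge0 u; lra.
have e'0 : 0 < e' by rewrite divr_gt0 // !mulr_gt0.
pose e2 := Num.min 1 (e / (2 * D)).
have e20 : 0 < e2 by rewrite lt_min ltr01 divr_gt0 // mulr_gt0.
have /cvgrPdist_lt/(_ _ e20) nu := uc.
have [k [k1 k2]] := filter_ex (filterI (small _ e'0) nu).
rewrite -/(uk k) lt_min in k2; have /andP[k3 k4] := k2.
have -> : u *m (1%:M - Pi) = (u - uk k) *m (1%:M - Pi) + uk k *m (1%:M - Pi).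
  by rewrite -mulmxDl subrK.
have n1 : `|uk k| <= `|u| + 1.
  have -> : uk k = u - (u - uk k) by rewrite opprB addrC subrK.
  by apply: le_trans (ler_normB _ _) _; rewrite lerD2l ltW.
apply: le_trans (ler_normD _ _) _.
have h1 : D * `|u - uk k| <= e / 2.
  rewrite mulrC -ler_pdivlMr // -mulrA -invfM; exact: ltW.
have h2 : D * (e' * `|uk k|) <= e / 4.
  apply: le_trans (_ : D * (e' * (`|u| + 1)) <= _); first by rewrite !ler_pM2l.
  by rewrite le_eqVlt; apply/orP; left; apply/eqP; rewrite /e'; field; rewrite !gt_eqF.
have := DP (u - uk k); lra.
Qed.

End Chart.

(** * Strict complementarity and identification of the active manifold *)

Section Identification.
Set Implicit Arguments. Unset Strict Implicit.
Context {R : realType} {n : nat}.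
Local Notation E := 'rV[R]_n.
Implicit Types (phi : E -> \bar R) (M C : set E) (x y v xs : E) (t r eps : R).

Lemma aff_hull_sub C c : C c -> aff_hull C c.
Proof.
move=> Cc; exists 1%N, (fun=> 1), (fun=> c); rewrite !big_ord1 scale1r.
by split.
Qed.

Lemma aff_hull_comb C (a b : R) x y : a + b = 1 -> aff_hull C x -> aff_hull C y ->
  aff_hull C (a *: x + b *: y).
Proof.
move=> ab [k1 [a1 [c1 [s1 C1 ->]]]] [k2 [a2 [c2 [s2 C2 ->]]]].
exists (k1 + k2)%N,
  (fun i => match fintype.split i with inl j => a * a1 j | inr j => b * a2 j end),
  (fun i => match fintype.split i with inl j => c1 j | inr j => c2 j end).
have sl (j : 'I_k1) : fintype.split (lshift k2 j) = inl j by rewrite (unsplitK (inl j)).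
have sr (j : 'I_k2) : fintype.split (rshift k1 j) = inr j by rewrite (unsplitK (inr j)).
split.
- rewrite big_split_ord /=; under eq_bigr do rewrite sl.
  under [X in _ + X]eq_bigr do rewrite sr.
  by rewrite -!mulr_sumr s1 s2 !mulr1.
- by move=> i; case: (fintype.split i).
- rewrite big_split_ord /= !scaler_sumr; congr (_ + _); apply: eq_bigr => j _.
    by rewrite sl scalerA.
  by rewrite sr scalerA.
Qed.

(** Two nested affine combinations of two points; the factor [1 + e] normalises the inner one. *)
Lemma aff_hull_translate C c a (e : R) : 0 < e -> aff_hull C c -> par_aff C a ->
  aff_hull C (c + e *: a).
Proof.
move=> e0 Cc [x [y [Cx Cy ->]]].
have e1 : 1 + e != 0 by rewrite gt_eqF //; lra.
have -> : c + e *: (x - y) =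
    (1 + e) *: ((1 + e)^-1 *: c + (e / (1 + e)) *: x) + (- e) *: y.
  by apply/rowP => i; rewrite !mxE; field.
apply: aff_hull_comb => //; first by lra.
by apply: aff_hull_comb => //; field.
Qed.

Lemma unit_kernel_compact (Pi : 'M[R]_n) :
  compact [set a : E | `|a| = 1 /\ a *m Pi = 0].
Proof.
apply: bounded_closed_compact.
  exists 1; split; first exact: num_real.
  by move=> B B1 a /= [-> _]; exact: ltW.
rewrite (_ : [set _ | _] = (fun a : E => `|a|) @^-1` [set 1] `&`
    (mulmxr Pi : E -> E) @^-1` [set 0]) //.
apply: closedI.
  apply: (@closed_comp _ _ (fun a : E => `|a|)); last exact: closed_eq.
  by move=> x _; exact: norm_continuous.
apply: (@closed_comp _ _ (mulmxr Pi : E -> E)).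
  by move=> x _; exact: linear_rV_continuous.
exact/accessible_closed_set1/hausdorff_accessible/norm_hausdorff.
Qed.

(* By strict complementarity [v + eta *: a] is a subgradient at [xs] for every
   unit normal [a]; inner semicontinuity moves it to nearby points of [M], and
   compactness of the unit normals makes this uniform in [a]. *)
Lemma normal_subgradients phi xs v M (Pi : 'M[R]_n) (V : set E) (e : R) :
  0 < e -> ri (lsubdiff phi xs) v ->
  (forall a, a *m Pi = 0 -> par_aff (lsubdiff phi xs) a) ->
  open V -> V v -> isc_rel (fun x' => V `&` lsubdiff phi x') M xs ->
  exists2 c : R, 0 < c & \forall x' \near xs, M x' ->
    forall a, `|a| = 1 -> a *m Pi = 0 ->
    exists z, [/\ lsubdiff phi x' z, enorm (z - v) < e & c <= inner (z - v) a].
Proof.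
move=> e0 [Cv [eri eri0 hri]] hpar oV Vv isc.
have N0 : 0 < n.+1%:R :> R by [].
set N : R := n.+1%:R in N0.
have [eV eV0 hV] := (near_enormP _ _).1 (open_nbhs_nbhs (conj oV Vv)).
(* Keeps [v + eta *: a] inside the relative-interior radius and inside [V], with room left for the
   later perturbation. *)
pose eta := Num.min e (Num.min eri eV) / (4 * N).
have eta0 : 0 < eta by rewrite divr_gt0 ?mulr_gt0 // !lt_min e0 eri0.
have etaN : 4 * (eta * N) = Num.min e (Num.min eri eV) by rewrite /eta; field; rewrite gt_eqF.
have [l1 l2 l3] : [/\ 4 * (eta * N) <= e, 4 * (eta * N) <= eri & 4 * (eta * N) <= eV].
  by rewrite etaN !ge_min !lexx !orbT.
have etaN0 : 0 < eta * N by rewrite mulr_gt0.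
exists (eta / 4); first by rewrite divr_gt0.
pose Q (x' a : E) := M x' ->
  exists z, [/\ lsubdiff phi x' z, enorm (z - v) < e & eta / 4 <= inner (z - v) a].
have /compact_near_coveringP cov := @unit_kernel_compact Pi.
have H : forall a, [set a : E | `|a| = 1 /\ a *m Pi = 0] a ->
    \forall a' \near a & x' \near nbhs xs, Q x' a'.
  move=> a [a1 aPi].
  have ea : enorm (eta *: a) <= eta * N.
    rewrite enormZ gtr0_norm // ler_pM2l //.
    by apply: le_trans (enorm_le_norm _) _; rewrite a1 mulr1.
  have dz : v + eta *: a - v = eta *: a by rewrite addrAC subrr add0r.
  have Cz : lsubdiff phi xs (v + eta *: a).
    apply: hri; last by rewrite dz; lra.
    by apply: aff_hull_translate => //; [exact: aff_hull_sub|exact: hpar].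
  have Vz : V (v + eta *: a) by apply: hV; rewrite dz; lra.
  (* Of the gain [eta / 2] along a nearby direction [a'], moving the subgradient by [s] costs at
     most [eta / 4], since [|a'| <= 2]. *)
  pose s := Num.min (e / 2) (eta / (8 * N)).
  have s0 : 0 < s by rewrite lt_min; apply/andP; split; apply: divr_gt0 => //; exact: mulr_gt0.
  have s1 : s <= e / 2 by rewrite ge_min lexx.
  have s2 : N * s <= eta / 8.
    apply: le_trans (_ : N * (eta / (8 * N)) <= _).
      by rewrite ler_pM2l // ge_min lexx orbT.
    by rewrite le_eqVlt; apply/orP; left; apply/eqP; field; rewrite gt_eqF.
  have [dl dl0 hdl] := isc _ (conj Vz Cz) s s0.
  exists ([set a' | `|a' - a| < (2 * N)^-1], [set x' | enorm (x' - xs) < dl]).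
    have N2 : 0 < (2 * N)^-1 by rewrite invr_gt0 mulr_gt0.
    split; first by apply: (near_normP a [set a' | `|a' - a| < (2 * N)^-1]).2; exists (2 * N)^-1.
    by apply: (near_enormP xs [set x' | enorm (x' - xs) < dl]).2; exists dl.
  move=> [a' x'] [/= ha' hx'] Mx'.
  have [z [[_ Cz'] ez]] := hdl _ Mx' hx'.
  have zv : z - v = (z - (v + eta *: a)) + eta *: a.
    by apply/rowP => i; rewrite !mxE; ring.
  exists z; split=> //.
    by rewrite zv; apply: le_lt_trans (enormD _ _) _; lra.
  have N2 : (2 * N)^-1 <= 2^-1.
    by rewrite lef_pV2 ?posrE ?mulr_gt0 // ler_peMr // ler1n.
  have na' : `|a'| <= 2.
    have -> : a' = (a' - a) + a by rewrite subrK.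
    apply: le_trans (ler_normD _ _) _; rewrite a1.
    by have := lt_le_trans ha' N2; lra.
  have h1 : - inner (z - (v + eta *: a)) a' <= N * s * 2.
    rewrite -innerNl; apply: le_trans (inner_le_norm _ _) _.
    rewrite normrN; apply: ler_pM => //.
    by rewrite ler_pM2l //; apply: le_trans (norm_le_enorm _) (ltW ez).
  have h2 : - inner a (a' - a) <= 2^-1.
    rewrite -innerNl; apply: le_trans (inner_le_norm _ _) _.
    rewrite normrN a1 mulr1; apply: le_trans (_ : N * (2 * N)^-1 <= _).
      by rewrite ler_pM2l // ltW.
    by rewrite le_eqVlt; apply/orP; left; apply/eqP; field; rewrite gt_eqF.
  have h3 : 1 <= inner a a.
    by have := norm_sqr_le_inner a; rewrite a1 expr1n.
  have h4 : 2^-1 <= inner a a'.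
    by move: h2; rewrite innerDr innerNr; lra.
  rewrite zv innerDl innerZl.
  have : eta * 2^-1 <= eta * inner a a' by rewrite ler_pM2l.
  lra.
have nQ : \forall x' \near nbhs xs,
    [set a : E | `|a| = 1 /\ a *m Pi = 0] `<=` Q x' by exact: cov H.
by move: nQ; apply: filterS => x' hx' Mx' a a1 aPi; exact: hx'.
Qed.

(* If the proximal point [x] were off [M], then with [xh] the point of [M] having
   the same tangent coordinate, [x - xh] is normal and the subgradient at [xh]
   leaning towards it violates hypomonotonicity of the subdifferential. *)
Lemma prox_identification phi xs v eps r t p M Pi chi d (g : E -> R) (Ug V : set E) :
  prox_model phi xs v eps r -> 0 < t < r^-1 -> chart p.+1 M xs Pi chi d ->
  open Ug -> Ug xs -> {for xs, continuous g} ->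
  (forall y, Ug y -> M y -> phi y = (g y)%:E) ->
  ri (lsubdiff phi xs) v -> (forall a, a *m Pi = 0 -> par_aff (lsubdiff phi xs) a) ->
  open V -> V v -> isc_rel (fun x' => V `&` lsubdiff phi x') M xs ->
  exists2 d1 : R, 0 < d1 & forall y x, enorm (y - (xs + t *: v)) < d1 ->
    prox t phi y x -> M x /\ chi (x - xs) = x.
Proof.
move=> pm ht ch oUg Ugxs cg phig hri hpar oV Vv isc.
have N0 : 0 < n.+1%:R :> R by [].
set N : R := n.+1%:R in N0.
have r0 := pm_r pm; have eps0 := pm_eps pm.
have [c c0 hc] := normal_subgradients eps0 hri hpar oV Vv isc.
have B0 : ball (0 : E) d 0 by apply: ballxx; exact: chart_gt0 ch.
have Mxs : M xs by rewrite -(chart0 ch); exact: chart_mem ch _ B0.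
have gxs : phi xs = (g xs)%:E by exact: phig.
have nG : \forall x' \near xs, M x' -> (phi x' < phi xs + eps%:E)%E.
  have /cvgrPdist_lt/(_ _ eps0) h1 : g x @[x --> xs] --> g xs := cg.
  have h2 : \forall x' \near xs, Ug x' by exact: open_nbhs_nbhs.
  near=> x'; move=> Mx'; rewrite phig //; last by near: x'.
  rewrite gxs -EFinD lte_fin.
  have : `|g xs - g x'| < eps by near: x'.
  by rewrite ltr_norml => /andP[]; lra.
(* As [|x - xh| <= 2 * k], the hypomonotonicity defect is at most [c / 4]; the deviation of the
   proximal subgradient costs another [c / 4], against a gain of [c]. *)
pose k := c / (8 * r * N); have k0 : 0 < k by rewrite divr_gt0 // !mulr_gt0.
have kE : r * N * k = c / 8 by rewrite /k; field; rewrite !gt_eqF.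
have nS : \forall x' \near xs, enorm (x' - xs) < Num.min eps k.
  by apply: (near_enormP _ _).2; exists (Num.min eps k) => //; rewrite lt_min eps0.
have cchi : {for 0, continuous chi} by exact: Ck_continuous (chart_Ck ch) B0.
have nchi : \forall w \near (0 : E), [/\ ball 0 d w,
    (forall a, `|a| = 1 -> a *m Pi = 0 -> exists z,
       [/\ lsubdiff phi (chi w) z, enorm (z - v) < eps & c <= inner (z - v) a]),
    (phi (chi w) < phi xs + eps%:E)%E & enorm (chi w - xs) < Num.min eps k].
  have nB : \forall w \near (0 : E), ball 0 d w.
    by apply: nbhsx_ballx; exact: chart_gt0 ch.
  have lift (P : set E) : (\forall x' \near xs, P x') -> \forall w \near (0 : E), P (chi w).
    by rewrite -(chart0 ch); exact: cchi.
  near=> w.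
  have Bw : ball 0 d w by near: w.
  have Mw : M (chi w) by exact: chart_mem ch _ Bw.
  split=> //.
  - by move: Mw; near: w; exact: lift hc.
  - by move: Mw; near: w; exact: lift nG.
  - by near: w; exact: lift nS.
have [d2 d20 hd2] := (near_normP _ _).1 nchi.
pose e := Num.min (Num.min eps d2) (Num.min k (c / (4 * N))).
have e0 : 0 < e by rewrite !lt_min eps0 d20 k0 divr_gt0 // mulr_gt0.
have [e1 e2 e3 e4] : [/\ e <= eps, e <= d2, e <= k & N * e <= c / 4].
  split; rewrite ?ge_min ?lexx ?orbT //.
  apply: le_trans (_ : N * (c / (4 * N)) <= _).
    by rewrite ler_pM2l // !ge_min lexx !orbT.
  by rewrite le_eqVlt; apply/orP; left; apply/eqP; field; rewrite gt_eqF.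
have [d1 d10 hd1] := prox_close pm ht e0.
exists d1 => // y x yd px; have [a1 a2 a3 a4] := hd1 _ _ yd px.
have [|Bw hz v1 v2] := hd2 (x - xs).
  by rewrite subr0; apply: le_lt_trans (norm_le_enorm _) _; lra.
suff xE : chi (x - xs) = x.
  by split=> //; rewrite -xE; exact: chart_mem ch _ Bw.
apply/eqP; rewrite eq_sym -subr_eq0; apply/negPn/negP => ne.
set xh := chi (x - xs) in hz v1 v2 ne.
have s0 : 0 < `|x - xh| by rewrite normr_gt0.
set s := `|x - xh| in s0.
pose a := s^-1 *: (x - xh).
have xa : x - xh = s *: a by rewrite /a scalerA mulfV ?scale1r // gt_eqF.
have na : `|a| = 1 by rewrite /a normrZ gtr0_norm ?invr_gt0 // mulVf // gt_eqF.
have aPi : a *m Pi = 0.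
  rewrite /a -scalemxAl (_ : x - xh = (x - xs) - (xh - xs)); last first.
    by apply/rowP => i; rewrite !mxE; ring.
  by rewrite mulmxBl (chart_coord ch Bw) subrr scaler0.
clearbody a; have [z [z1 z2 z3]] := hz _ na aPi.
rewrite lt_min in v2; have /andP[v3 v4] := v2.
have lt4 : (phi x < phi xs + eps%:E)%E.
  by apply: lt_le_trans a4 _; rewrite leeD2l // lee_fin.
have := prox_model_monotone pm (rsubdiff_lsubdiff a1) (lt_le_trans a2 e1)
  (lt_le_trans a3 e1) lt4 z1 z2 v3 v1.
rewrite xa !(innerZl s a) !innerZr (_ : t^-1 *: (y - x) - z = (t^-1 *: (y - x) - v) - (z - v)); last first.
  by apply/rowP => i; rewrite !mxE; ring.
rewrite (innerDl _ (- (z - v))) (innerNl (z - v)).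
set w1 := t^-1 *: (y - x) - v in a2 *.
have i1 : inner w1 a <= N * e.
  apply: le_trans (inner_le_norm _ _) _; rewrite na mulr1 ler_pM2l //.
  by apply: ltW; apply: le_lt_trans (norm_le_enorm _) a2.
have i2 : inner a a <= N.
  by apply: le_trans (inner_le_norm _ _) _; rewrite na !mulr1.
have sk : s <= 2 * k.
  have -> : s = `|(x - xs) - (xh - xs)|.
    by rewrite /s; congr (`|_|); apply/rowP => i; rewrite !mxE; ring.
  apply: le_trans (ler_normB _ _) _.
  have := norm_le_enorm (x - xs); have := norm_le_enorm (xh - xs); lra.
move=> h.
have h2 : 0 <= s * (inner w1 a - inner (z - v) a + r * (s * inner a a)) by lra.
rewrite pmulr_rge0 // in h2.
have h3 : r * (s * inner a a) <= r * (2 * k * N).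
  by rewrite ler_pM2l // ler_pM // ?inner_ge0 // ltW.
lra.
Unshelve. all: by end_near. Qed.

End Identification.

(** * First- and second-order conditions at a minimum *)

Section Smoothness.
Set Implicit Arguments. Unset Strict Implicit.
Context {R : realType} {n : nat}.
Local Notation E := 'rV[R]_n.
Local Notation EE := 'rV[R]_(n + n).
Implicit Types (phi : E -> \bar R) (M C : set E) (x y v xs : E) (t r eps : R).

Lemma local_min_derive0 (V : normedModType R) (f : V -> R) (a w : V) :
  differentiable f a -> (\forall z \near a, f a <= f z) -> 'D_w f a = 0.
Proof.
move=> df fmin.
have [->|w0] := eqVneq w 0; first by rewrite deriveE // linear0.
have nw : 0 < `|w| by rewrite normr_gt0.
have half (u : V) (e : R) : `|u| = `|w| -> 0 < e -> - 'd f a u <= e * `|w|.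
  move=> uw e0.
  have [d1 d10 h1] := (near_normP _ _).1 (diff_eps df e0).
  have [d2 d20 h2] := (near_normP _ _).1 fmin.
  pose s := Num.min d1 d2 / (2 * `|w|).
  have m0 : 0 < Num.min d1 d2 by rewrite lt_min d10.
  have s0 : 0 < s by rewrite divr_gt0 // mulr_gt0.
  have sw : `|s *: u| = Num.min d1 d2 / 2.
    by rewrite normrZ gtr0_norm // uw /s; field; rewrite gt_eqF.
  have [l1 l2] : Num.min d1 d2 <= d1 /\ Num.min d1 d2 <= d2.
    by rewrite !ge_min !lexx orbT.
  have := h1 (s *: u); rewrite subr0 sw => h3.
  have {h3} : `|f (a + s *: u) - f a - 'd f a (s *: u)| <= e * (Num.min d1 d2 / 2).
    by apply: h3; lra.
  have : f a <= f (a + s *: u).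
    by apply: h2; rewrite addrAC subrr add0r sw; lra.
  have -> : Num.min d1 d2 / 2 = s * `|w| by rewrite -sw normrZ gtr0_norm // uw.
  rewrite linearZ /= /GRing.scale /= ler_norml => h3 /andP[h4 h5].
  by rewrite -(ler_pM2l s0); lra.
have le0 u : `|u| = `|w| -> - 'd f a u <= 0.
  move=> uw; apply/ler_addgt0Pr => e e0; rewrite add0r.
  have := half u (e / `|w|) uw (divr_gt0 e0 nw).
  by rewrite divfK // gt_eqF.
rewrite deriveE //; have := le0 w erefl; have := le0 (- w) (normrN w).
rewrite linearN opprK => h1 h2; apply/eqP; rewrite eq_le h1 /=; lra.
Qed.

Lemma open_preimage_linear m k (L : {linear 'rV[R]_m -> 'rV[R]_k}) (A : set 'rV[R]_k) :
  open A -> open [set q | A (L q)].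
Proof.
move=> oA; apply: (@open_comp _ _ L); last exact: oA.
by move=> q _; exact: linear_rV_continuous.
Qed.

Lemma Ck_row_mx (V : normedModType R) m1 m2 k (f : V -> 'rV[R]_m1)
    (g : V -> 'rV[R]_m2) (U : set V) : open U ->
  Ck k f U -> Ck k g U -> Ck k (fun z => row_mx (f z) (g z)) U.
Proof.
move=> oU Cf Cg; apply: Ck_rV => // j; case: (splitP j) => i ij.
  have -> : j = lshift m2 i by apply/val_inj.
  by under eq_fun do rewrite row_mxEl; exact: Ck_coord.
have -> : j = rshift m1 i by apply/val_inj.
by under eq_fun do rewrite row_mxEr; exact: Ck_coord.
Qed.

Lemma row_mx_norm m1 m2 (a : 'rV[R]_m1) (b : 'rV[R]_m2) (c : R) :
  `|a| < c -> `|b| < c -> `|row_mx a b| < c.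
Proof.
move=> ac bc; apply: le_lt_trans (_ : Num.max `|a| `|b| < c).
  apply: norm_coord => [|i j]; first by rewrite le_max normr_ge0.
  rewrite mxE; case: (fintype.split j) => k.
    by rewrite le_max coord_norm.
  by rewrite le_max coord_norm orbT.
by rewrite gt_max ac.
Qed.

(** The mean value theorem writes the increment as [s] times a first derivative at an intermediate
    point, and that derivative is [o(s)] because its own derivative along [w] vanishes. No
    second-order Taylor formula is involved. *)
Lemma second_order_strict (F : EE -> R) (q0 w : EE) (Q : set EE) (c : R) :
  open Q -> Q q0 -> Ck 2 F Q -> 0 < c ->
  'D_w F q0 = 0 -> 'D_w ('D_w F) q0 = 0 ->
  (\forall s \near (0 : R), F q0 + c * s ^+ 2 <= F (q0 + s *: w)) -> False.
Proof.
move=> oQ Qq0 [dF DF] c0 D1 D2 gr.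
have [dDF _] := DF w.
have nQ : \forall q \near q0, Q q by exact: open_nbhs_nbhs.
have [dQ dQ0 hQ] := (near_normP _ _).1 nQ.
have [dg dg0 hg] := (near_normP _ _).1 gr.
pose W := `|w| + 1; have W0 : 0 < W by have := normr_ge0 w; rewrite /W; lra.
(* Makes the upper bound on the increment half of the assumed growth. *)
pose e := c / (2 * W); have e0 : 0 < e by rewrite divr_gt0 // mulr_gt0.
have [d1 d10 h1] := (near_normP _ _).1 (diff_eps (dDF _ Qq0) e0).
pose s := Num.min dg (Num.min (dQ / W) (d1 / W)) / 2.
have m0 : 0 < Num.min dg (Num.min (dQ / W) (d1 / W)) by rewrite !lt_min dg0 !divr_gt0.
have s0 : 0 < s by rewrite divr_gt0.
have [l1 l2 l3] : [/\ s < dg, s < dQ / W & s < d1 / W].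
  have : s < Num.min dg (Num.min (dQ / W) (d1 / W)) by rewrite /s; lra.
  by rewrite !lt_min => /andP[-> /andP[-> ->]].
clearbody s.
have sw z : 0 <= z <= 1 -> `|z *: (s *: w)| <= z * (s * W).
  move=> /andP[z0 z1]; rewrite !normrZ (ger0_norm z0) gtr0_norm //.
  apply: ler_wpM2l => //. apply: ler_wpM2l; first exact: ltW.
  by rewrite /W; lra.
have sW : s * W < dQ /\ s * W < d1 by rewrite -!ltr_pdivlMr.
have zW z : 0 <= z <= 1 -> z * (s * W) <= s * W.
  by move=> /andP[z0 z1]; rewrite ger_pMl // mulr_gt0.
have [|z /andP[z0 z1] E] := @MVT_line _ _ F q0 (s *: w).
  move=> z z01; apply: dF; apply: hQ; rewrite addrAC subrr add0r.
  by have := sw _ z01; have := zW _ z01; lra.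
have z01 : 0 <= z <= 1 by rewrite !ltW.
have Qz : Q (q0 + z *: (s *: w)).
  apply: hQ; rewrite addrAC subrr add0r.
  by have := sw _ z01; have := zW _ z01; lra.
have DE : 'D_(s *: w) F (q0 + z *: (s *: w)) = s * 'D_w F (q0 + z *: (s *: w)).
  have dz := dF _ Qz; by rewrite !deriveE // linearZ.
have := h1 (z *: (s *: w)); rewrite subr0 => h2.
have {h2} : `|'D_w F (q0 + z *: (s *: w)) - 'D_w F q0 - 'd ('D_w F) q0 (z *: (s *: w))|
    <= e * `|z *: (s *: w)|.
  by apply: h2; have := sw _ z01; have := zW _ z01; lra.
have dDFq := dDF _ Qq0.
have -> : 'd ('D_w F) q0 (z *: (s *: w)) = 0.
  by rewrite scalerA linearZ -deriveE // D2; exact: (@scaler0 R R).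
rewrite D1 !subr0 => h2.
have h3 : 'D_w F (q0 + z *: (s *: w)) <= e * (s * W).
  apply: le_trans (ler_norm _) _; apply: le_trans h2 _; rewrite ler_pM2l //.
  by apply: le_trans (sw _ z01) (zW _ z01).
have := hg s; rewrite subr0 gtr0_norm // => /(_ l1) h4.
have h5 : c * s ^+ 2 <= s * (e * (s * W)).
  apply: le_trans (_ : s * 'D_w F (q0 + z *: (s *: w)) <= _); last by rewrite ler_pM2l.
  by rewrite -DE -E; lra.
have : s * (e * (s * W)) = c * s ^+ 2 / 2 by rewrite /e; field; rewrite gt_eqF.
have : 0 < c * s ^+ 2 by rewrite mulr_gt0 // exprn_gt0.
lra.
Qed.

End Smoothness.

(** * The proximal map in a chart of the active manifold *)

Section ProxSmooth.
Set Implicit Arguments. Unset Strict Implicit.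
Context {R : realType} {n : nat}.
Local Notation E := 'rV[R]_n.
Local Notation EE := 'rV[R]_(n + n).
Implicit Types (phi : E -> \bar R) (M C : set E) (x y v xs : E) (t r eps : R).

Let lsubL : {linear EE -> E} := (lsubmx : {linear 'M[R]_(1, n + n) -> 'M[R]_(1, n)}).
Let rsubL : {linear EE -> E} := (rsubmx : {linear 'M[R]_(1, n + n) -> 'M[R]_(1, n)}).

(** An implicit function theorem for the criticality equation in [u] with parameter [y], obtained by
    inverting [H], which carries [y] along; the proximal map is then [chi] applied to the
    solution. *)
Lemma prox_smooth phi xs v eps r t k M Pi chi d (g : E -> R) (Ug : set E) :
  prox_model phi xs v eps r -> 0 < t < r^-1 -> chart k.+2 M xs Pi chi d ->
  open Ug -> Ug xs -> Ck k.+2 g Ug ->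
  (forall y, Ug y -> M y -> phi y = (g y)%:E) ->
  (exists2 d1 : R, 0 < d1 & forall y x, enorm (y - (xs + t *: v)) < d1 ->
    prox t phi y x -> M x /\ chi (x - xs) = x) ->
  exists O : set E, [/\ open O, O (xs + t *: v) & setmap_Ck_on k.+1 (prox t phi) O].
Proof.
move=> pm ht ch oUg Ugxs Cg phig [d1 d10 ident].
have /andP[t0 tr] := ht; have fx := pm_fin pm.
have rt : r < t^-1 by rewrite -[r]invrK ltf_pV2 ?posrE ?invr_gt0 //; exact: pm_r pm.
have dpos := chart_gt0 ch; have oP := chart_proj ch; have [sP iP] := oP.
set y0 := xs + t *: v in ident *.
pose Pn := 1%:M - Pi : 'M[R]_n.
have B0 : ball (0 : E) d 0 by exact: ballxx.
have [P P0 [d0 d00 PP]] := prox_map_exists pm ht; rewrite -/y0 in P0 PP.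
have cchi : {for 0, continuous chi} by exact: Ck_continuous (chart_Ck ch) B0.
have [d2 d20 hd2] : exists2 d2 : R, 0 < d2 &
    forall u, ball (0 : E) d2 u -> ball 0 d u /\ Ug (chi u).
  have nB : nbhs (0 : E) (ball 0 d `&` chi @^-1` Ug).
    apply: filterI; first exact: nbhsx_ballx.
    by apply: cchi; rewrite (chart0 ch); exact: open_nbhs_nbhs.
  by have [d2 /= d20 hd2] := (nbhs_ballP _ _).1 nB; exists d2.
have inB (u : E) : `|u| < d2 -> ball (0 : E) d2 u.
  by move=> ud; rewrite -ball_normE /= sub0r normrN.
(* [chi] depends only on [u *m Pi], so without the last term the Hessian in [u] would be degenerate.
   That term vanishes at tangential [u], so minimality of the proximal point survives. *)
pose K (q : EE) := g (chi (lsubL q)) + qpen t (rsubL q) (chi (lsubL q))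
  + inner (lsubL q *m Pn) (lsubL q *m Pn).
pose Q : set EE := [set q | ball (0 : E) d2 (lsubL q)].
have oQ : open Q by apply: open_preimage_linear; exact: ball_open.
have Cl j : Ck j lsubL Q by apply: Ck_lin; exact: linear_rV_continuous.
have Cr j : Ck j rsubL Q by apply: Ck_lin; exact: linear_rV_continuous.
have oB2 : open (ball (0 : E) d2) by exact: ball_open.
have Cchi : Ck k.+2 (fun q => chi (lsubL q)) Q.
  apply: (Ck_comp oQ oB2 _ (Cl _) _) => //.
  by apply: Ck_sub (chart_Ck ch) => u /hd2[].
have CK : Ck k.+2 K Q.
  have C1 : Ck k.+2 (fun q => g (chi (lsubL q))) Q.
    by apply: (Ck_comp oQ oUg _ Cchi Cg) => q /hd2[].
  have C2 : Ck k.+2 (fun q => chi (lsubL q) - rsubL q) Q.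
    exact: (Ck_add oQ Cchi (Ck_opp oQ (Cr _))).
  have C3 : Ck k.+2 (fun q => lsubL q *m Pn) Q by exact: (Ck_mulmxc Pn oQ (Cl _)).
  have C4 : Ck k.+2 (fun q => qpen t (rsubL q) (chi (lsubL q))) Q.
    exact: (Ck_mul oQ (@Ck_cst _ _ _ _ _ _) (Ck_inner oQ C2 C2)).
  exact: (Ck_add oQ (Ck_add oQ C1 C4) (Ck_inner oQ C3 C3)).
have lE (a b : E) : lsubL (row_mx a b) = a by exact: row_mxKl.
have rE (a b : E) : rsubL (row_mx a b) = b by exact: row_mxKr.
pose G (q : EE) : E := \row_j 'D_(row_mx (delta_mx 0 j) 0) K q.
have CG : Ck k.+1 G Q.
  apply: Ck_rV => // j; have [_ DK] := CK.
  by under eq_fun do rewrite mxE; exact: DK.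
pose H (q : EE) : EE := row_mx (G q) (rsubL q).
have CH : Ck k.+1 H Q by apply: Ck_row_mx.
pose q0 : EE := row_mx 0 y0.
have Qq0 : Q q0 by rewrite /Q /= lE; exact: ballxx.
have DKw (q : EE) (a : E) : Q q -> 'D_(row_mx a 0) K q = \sum_j a 0 j * G q 0 j.
  move=> Qq; have dK := Ck_diff (ltn0Sn _) CK Qq.
  have -> : row_mx a 0 = \sum_j a 0 j *: (row_mx (delta_mx 0 j) 0 : EE).
    have IE (b : E) : row_mx b 0 = b *m (row_mx 1%:M 0 : 'M[R]_(n, n + n)).
      by rewrite mul_mx_row mulmx1 mulmx0.
    rewrite IE [in LHS](row_sum_delta a) mulmx_suml; apply: eq_bigr => j _.
    by rewrite IE scalemxAl.
  rewrite deriveE // linear_sum; apply: eq_bigr => j _.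
  by rewrite linearZ mxE deriveE.
(* The reduced objective [K (row_mx u y)] is minimal in [u] at the chart
   coordinate of the proximal point, hence critical there. *)
have crit y : enorm (y - y0) < d0 -> enorm (y - y0) < d1 ->
    `|(P y - xs) *m Pi| < d2 ->
    chi ((P y - xs) *m Pi) = P y /\ G (row_mx ((P y - xs) *m Pi) y) = 0.
  move=> yd0 yd1 ud2; have px : prox t phi y (P y) by rewrite PP.
  have [MP cP] := ident _ _ yd1 px.
  have cE : chi ((P y - xs) *m Pi) = P y by rewrite (chart_Pi ch).
  split=> //; set u := (P y - xs) *m Pi in ud2 cE *.
  have uPn : u *m Pn = 0 by rewrite /u /Pn -mulmxA mulmxBr mulmx1 iP subrr mulmx0.
  have Qu : Q (row_mx u y) by rewrite /Q /= lE; exact: inB.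
  apply/rowP => j; rewrite !mxE.
  have dK := Ck_diff (ltn0Sn _) CK Qu.
  have E1 s : row_mx u y + s *: row_mx (delta_mx 0 j) 0 = row_mx (u + s *: delta_mx 0 j) y :> EE.
    by rewrite scale_row_mx scaler0 add_row_mx addr0.
  have dl : is_derive (0 : R) 1 (fun s : R => K (row_mx u y + s *: row_mx (delta_mx 0 j) 0))
      ('D_(row_mx (delta_mx 0 j) 0) K (row_mx u y + 0 *: row_mx (delta_mx 0 j) 0)).
    by apply: is_derive_line; rewrite scale0r addr0.
  have := @derive_val _ _ _ _ _ _ _ dl; rewrite scale0r addr0 => <-.
  apply: local_min_derive0; first by apply/derivable1_diffP; case: dl.
  have nB : \forall z \near u, ball (0 : E) d2 z.
    by apply: open_nbhs_nbhs; split=> //; exact: inB.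
  have [e e0 he] := (near_normP _ _).1 nB.
  apply/near_normP; exists (e / (`|delta_mx 0 j : E| + 1)).
    by rewrite divr_gt0 // ltr_wpDl.
  move=> s; rewrite subr0 ltr_pdivlMr ?ltr_wpDl // => hs; rewrite scale0r addr0 E1.
  have Bz : ball (0 : E) d2 (u + s *: delta_mx 0 j).
    apply: he; rewrite addrAC subrr add0r normrZ; apply: le_lt_trans hs.
    by rewrite ler_wpM2l // lerDl.
  set z := u + s *: delta_mx 0 j in Bz *.
  have [Bz1 Uz] := hd2 _ Bz; have [_ Uu] := hd2 _ (inB _ ud2).
  have := px (chi z); rewrite (phig _ Uz (chart_mem ch Bz1)).
  have -> : phi (P y) = (g (P y))%:E by apply: phig => //; rewrite -cE.
  rewrite -!EFinD lee_fin /K !lE !rE cE uPn inner0l addr0 => h.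
  by apply: le_trans h _; rewrite lerDl inner_ge0.
have y0d (e : R) : 0 < e -> enorm (y0 - y0) < e by rewrite subrr /enorm inner0l sqrtr0.
have u00 : (P y0 - xs) *m Pi = 0 by rewrite P0 subrr mul0mx.
have [_ G0] : chi ((P y0 - xs) *m Pi) = P y0 /\ G (row_mx ((P y0 - xs) *m Pi) y0) = 0.
  by apply: crit; [exact: y0d|exact: y0d|rewrite u00 normr0].
rewrite u00 -/q0 in G0.
(* Growth rate in tangential directions, from [prox_growth], against rate [1] in normal directions,
   from the added term. *)
pose c := Num.min ((t^-1 - r) / 2) 1.
have c0 : 0 < c by rewrite lt_min ltr01 andbT; lra.
have [c1 c2] : c <= (t^-1 - r) / 2 /\ c <= 1 by rewrite !ge_min !lexx orbT.
have growth (u : E) : ball (0 : E) d2 u ->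
    K q0 + c * `|u| ^+ 2 <= K (row_mx u y0).
  move=> Bu; have [Bu1 Uu] := hd2 _ Bu.
  have := prox_growth y0 (chi u) pm t0.
  rewrite -/y0 subrr inner0r mulr0 subr0 (phig _ Uu (chart_mem ch Bu1)).
  have Mxs : M xs by rewrite -(chart0 ch); exact: chart_mem ch _ B0.
  rewrite (phig _ Ugxs Mxs) -!EFinD lee_fin => h.
  rewrite /K !lE !rE (chart0 ch) mul0mx inner0l addr0.
  have := orth_projection_pythagoras (chi u - xs) oP.
  rewrite (chart_coord ch Bu1) => p1.
  have := orth_projection_pythagoras u oP; rewrite -/Pn => p2.
  have i1 := inner_ge0 ((chi u - xs) *m (1%:M - Pi)).
  have i2 := inner_ge0 (u *m Pi); have i3 := inner_ge0 (u *m Pn).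
  have n1 : c * `|u| ^+ 2 <= c * inner u u by rewrite ler_pM2l // norm_sqr_le_inner.
  have n2 : c * inner (u *m Pi) (u *m Pi) <= (t^-1 - r) / 2 * inner (u *m Pi) (u *m Pi).
    by rewrite ler_wpM2r.
  have n3 : c * inner (u *m Pn) (u *m Pn) <= 1 * inner (u *m Pn) (u *m Pn).
    by rewrite ler_wpM2r.
  have n4 : (t^-1 - r) / 2 * inner (u *m Pi) (u *m Pi) <=
      (t^-1 - r) / 2 * inner (chi u - xs) (chi u - xs).
    by rewrite ler_pM2l; [lra|lra].
  rewrite p2 mulrDr in n1; lra.
(* The second block of [H] forces [w = row_mx a 0]; the first then kills the second derivative of
   [K] along [w], contrary to quadratic growth unless [a = 0]. *)
have inj (w : EE) : 'D_w H q0 = 0 -> w = 0.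
  move=> DH0; have dH := Ck_diff (ltn0Sn _) CH Qq0.
  have dG := Ck_diff (ltn0Sn _) CG Qq0.
  have lin_cont m1 m2 (L : {linear 'rV[R]_m1 -> 'rV[R]_m2}) z : differentiable L z.
    by apply: linear_differentiable; exact: linear_rV_continuous.
  have Dl : 'D_w (lsubL \o H) q0 = 0.
    by rewrite derive_comp // DH0 derive0.
  have Dr : 'D_w (rsubL \o H) q0 = 0.
    by rewrite derive_comp // DH0 derive0.
  have lH : lsubL \o H = G by apply/funext => q; exact: lE.
  have rH : rsubL \o H = rsubL by apply/funext => q; exact: rE.
  rewrite lH in Dl; rewrite rH derive_lin in Dr; last exact: linear_rV_continuous.
  pose a : E := lsubL w.
  have wE : w = row_mx a 0.
    by rewrite -[0 in RHS]Dr /a; rewrite [LHS](esym (hsubmxK w)).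
  clearbody a.
  suff a0 : a = 0 by rewrite wE a0 row_mx0.
  apply/eqP/negPn/negP => an0; have na : 0 < `|a| by rewrite normr_gt0.
  apply: (@second_order_strict R n K q0 w Q (c * `|a| ^+ 2) oQ Qq0).
  - by apply: Ck_le CK.
  - by rewrite mulr_gt0 // exprn_gt0.
  - by rewrite wE DKw // G0 big1 // => j _; rewrite mxE mulr0.
  - have nQ : \forall q \near q0, Q q by exact: open_nbhs_nbhs.
    have sumE : \forall q \near q0, \sum_j a 0 j * G q 0 j = 'D_w K q.
      by apply: filterS nQ => q Qq; rewrite wE DKw.
    rewrite -(near_eq_derive w sumE).
    have -> : (fun q => \sum_j a 0 j * G q 0 j) = coordL 0 0 \o (mulmxr a^T \o G).
      apply/funext => q; rewrite /= mxE; apply: eq_bigr => j _.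
      by rewrite [a^T _ _]mxE mulrC.
    have dS : differentiable (mulmxr a^T : E -> 'rV[R]_1) (G q0).
      exact: (lin_cont _ _ (mulmxr a^T : {linear E -> 'rV[R]_1})).
    have dm : differentiable (mulmxr a^T \o G) q0 by exact: differentiable_comp.
    rewrite derive_comp //; last first.
      by apply: linear_differentiable; exact: linear_rV_continuous.
    by rewrite (derive_comp w dG dS) Dl !derive0.
  apply/near_normP; exists (d2 / `|a|); first by rewrite divr_gt0.
  move=> s; rewrite subr0 ltr_pdivlMr // => hs.
  rewrite wE /q0 scale_row_mx scaler0 add_row_mx add0r addr0 -/q0.
  have := growth (s *: a); rewrite normrZ exprMn real_normK ?num_real // => gr.
  by rewrite -mulrA [_ * s ^+ 2]mulrC; apply: gr; apply: inB; rewrite normrZ.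
have [A [W [Th [[oA Aq0 AQ] [oW CTh ThH HTh]]]]] := inverse_function oQ Qq0 CH inj.
pose C := ((t^-1 - r) / 2 * t)^-1.
have C0 : 0 < C by rewrite invr_gt0 mulr_gt0 //; lra.
have [D D0 DP] := mulmx_bound Pi.
have [dA dA0 hA] := (near_normP _ _).1 (open_nbhs_nbhs (conj oA Aq0)).
(* [D * C] converts the distance of [y] from [y0] into a bound on the chart coordinate, placing the
   pair in the domain of the local inverse. *)
pose ey := Num.min (Num.min d0 d1) (Num.min dA (Num.min d2 dA / (D * C))).
have m0 : 0 < Num.min d2 dA by rewrite lt_min d20.
have DC0 : 0 < D * C by exact: mulr_gt0.
have ey0 : 0 < ey by rewrite !lt_min d00 d10 dA0 /=; exact: divr_gt0.
pose O : set E := [set y | enorm (y - y0) < ey].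
have oO : open O by exact: open_enorm_ball.
have key y : O y -> prox t phi y = [set P y] /\
    [/\ W (row_mx 0 y), ball (0 : E) d2 (lsubL (Th (row_mx 0 y))) &
        chi (lsubL (Th (row_mx 0 y))) = P y].
  rewrite /O /= !lt_min ltr_pdivlMr ?mulr_gt0 // => /andP[/andP[yd0 yd1] /andP[ydA ydu]].
  have pE := PP _ yd0; have px : prox t phi y (P y) by rewrite pE.
  have un : `|(P y - xs) *m Pi| < Num.min d2 dA.
    apply: le_lt_trans (DP _) _; apply: le_lt_trans ydu.
    rewrite mulrCA ler_pM2l // mulrC.
    apply: le_trans (norm_le_enorm _) _; exact: prox_near pm ht px.
  rewrite lt_min in un; have /andP[un2 unA] := un.
  have [cE Gu] := crit _ yd0 yd1 un2.
  have Aq : A (row_mx ((P y - xs) *m Pi) y).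
    apply: hA; rewrite /q0 opp_row_mx add_row_mx subr0; apply: row_mx_norm => //.
    exact: le_lt_trans (norm_le_enorm _) ydA.
  have [WH ThE] := ThH _ Aq.
  have HE : H (row_mx ((P y - xs) *m Pi) y) = row_mx 0 y by rewrite /H Gu rE.
  rewrite HE in WH ThE; split=> //; split=> //; rewrite ThE lE //.
  exact: inB.
exists O; split=> //; first by rewrite /O /= -/y0; exact: y0d.
exists (fun y => chi (lsubL (Th (row_mx 0 y)))); split.
  by move=> y /key[-> [_ _ ->]].
have CT : Ck k.+1 (fun y => lsubL (Th (row_mx 0 y))) O.
  apply: Ck_lincomp => //; first exact: linear_rV_continuous.
  apply: (Ck_comp oO oW _ _ CTh); first by move=> y /key[_ []].
  by apply: Ck_row_mx => //; [exact: Ck_cst|exact: Ck_id].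
apply: (Ck_comp oO oB2 _ CT _); first by move=> y /key[_ []].
by apply: Ck_pred; apply: Ck_sub (chart_Ck ch) => u /hd2[].
Qed.

End ProxSmooth.

(** * The Douglas-Rachford operator *)

Section Assembly.
Set Implicit Arguments. Unset Strict Implicit.
Context {R : realType} {n : nat}.
Local Notation E := 'rV[R]_n.
Implicit Types (phi : E -> \bar R) (M : set E) (x y v xs : E) (t r eps : R).

(** Partial smoothness describes the span of regular subgradients, identification uses limiting
    ones; prox-regularity makes the two sets equal. *)
Lemma partly_smooth_prox_Ck k phi xs v eps r t M :
  prox_model phi xs v eps r -> 0 < t < r^-1 -> prox_regular phi ->
  ri (lsubdiff phi xs) v -> Cp_submanifold k.+2 M -> partly_smooth k.+2 phi xs v M ->
  exists O : set E, [/\ open O, O (xs + t *: v) & setmap_Ck_on k.+1 (prox t phi) O].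
Proof.
move=> pm ht reg hri sm [Mxs [Ug [g [oUg Ugxs Cg phig]]] _ hpar [V [oV Vv isc]]].
have [Pi [chi [d ch]]] := submanifold_chart sm Mxs.
apply: (prox_smooth pm ht ch oUg Ugxs Cg phig).
apply: (prox_identification pm ht ch oUg Ugxs _ phig hri _ oV Vv isc).
  exact: Ck_continuous Cg Ugxs.
move=> a /(chart_normal ch); rewrite -hpar.
suff -> : rsubdiff phi xs = lsubdiff phi xs by [].
by apply/seteqP; split=> z; [exact: rsubdiff_lsubdiff|exact: prox_regular_rsubdiff].
Qed.

(** The alternative stands under the quantifier on [t] because its second branch depends on [t],
    while the threshold does not depend on the branch. *)
Lemma prox_Ck k phi xs v : proper_fun phi -> closed_fun phi -> prox_bounded phi ->
  prox_regular phi -> lsubdiff phi xs v ->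
  exists2 t0 : R, 0 < t0 & forall t, 0 < t < t0 ->
    (ri (lsubdiff phi xs) v /\
       (exists M, [/\ Cp_submanifold k.+2 M, M xs & partly_smooth k.+2 phi xs v M])) \/
    [/\ twice_epi_diff phi xs v, gen_quadratic_subderiv2 phi xs v,
       closed [set y | ~ setmap_diff_at (prox t phi) y] &
       setmap_Ck_on k.+1 (prox t phi) [set y | setmap_diff_at (prox t phi) y]] ->
    prox t phi (xs + t *: v) xs /\
    exists O : set E, [/\ open O, O (xs + t *: v) & setmap_Ck_on k.+1 (prox t phi) O].
Proof.
move=> pr cl bd reg lv.
have [eps [r pm]] := prox_model_exists pr cl bd reg lv.
exists r^-1; first by rewrite invr_gt0; exact: pm_r pm.
move=> t ht cond; split.
  have [P P0 [d d0 PP]] := prox_map_exists pm ht.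
  by rewrite PP ?P0 // subrr /enorm inner0l sqrtr0.
case: cond => [[hri [M [sm _ ps]]]|[epi gq cls Cg]].
  exact: (partly_smooth_prox_Ck pm ht reg hri sm ps).
exists [set y | setmap_diff_at (prox t phi) y]; split=> //.
  rewrite (_ : [set y | _] = ~` [set y | ~ setmap_diff_at (prox t phi) y]).
    exact: closed_openC.
  by apply/seteqP; split=> y /=; rewrite notK.
exact: (prox_differentiable pm ht epi gq).
Qed.

Lemma setmap_Ck_on_FDRS k t phi psi xs w (Of Oh : set E) :
  open Of -> open Oh -> Of (xs - t *: w) -> Oh (xs + t *: w) ->
  prox t psi (xs + t *: w) xs ->
  setmap_Ck_on k (prox t phi) Of -> setmap_Ck_on k (prox t psi) Oh ->
  exists U : set E, [/\ open U, U (xs + t *: w) & setmap_Ck_on k (F_DRS t phi psi) U].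
Proof.
move=> oOf oOh Ofx Ohx px [gf [fE Cf]] [gh [hE Ch]].
have ghx : gh (xs + t *: w) = xs by move: px; rewrite hE.
pose m z := 2 *: gh z - z.
have Cm : Ck k m Oh.
  apply: Ck_add => //; last by apply: Ck_opp => //; exact: Ck_id.
  exact: (Ck_scale oOh (@Ck_cst _ _ _ _ _ _) Ch).
pose U := Oh `&` m @^-1` Of.
have oU : open U.
  rewrite openE => z [Oz Mz]; apply: filterI; first exact: open_nbhs_nbhs.
  by apply: (Ck_continuous Cm Oz); exact: open_nbhs_nbhs.
exists U; split=> //.
  split=> //; rewrite /preimage /= /m ghx (_ : _ - _ = xs - t *: w) //.
  by apply/rowP => i; rewrite !mxE; ring.
exists (fun z => gh z - gf (m z)); split.
  move=> z [Oz Mz]; apply/seteqP; split=> x.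
    by move=> [a [b [+ + ->]]]; rewrite hE // => ->; rewrite fE // => ->.
  move=> ->; exists (gh z), (gf (m z)); rewrite hE //; split=> //.
  by rewrite -/(m z) fE.
have sU : U `<=` Oh by move=> z [].
apply: Ck_add => //; first exact: Ck_sub sU Ch.
apply: Ck_opp => //.
by apply: (Ck_comp oU oOf _ (Ck_sub sU Cm) Cf) => z [].
Qed.

End Assembly.

Theorem theorem4p8 (R : realType) (n p : nat) (f h : 'rV[R]_n -> \bar R)
    (xs w : 'rV[R]_n) :
  (2 <= p)%N ->
  proper_fun f -> proper_fun h -> closed_fun f -> closed_fun h ->
  prox_bounded f -> prox_bounded h -> prox_regular f -> prox_regular h ->
  lsubdiff f xs (- w) -> lsubdiff h xs w ->
  exists2 t0 : R, 0 < t0 &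
    forall t : R, 0 < t < t0 ->
      condB1 p f h xs w \/ condB2 p t f h xs w ->
      exists U : set 'rV[R]_n,
        [/\ open U, U (xs + t *: w) & setmap_Ck_on p.-1 (F_DRS t f h) U].
Proof.
(* From here [p] is [k.+2]: the manifold data have order [k.+2] and the maps order [k.+1]. *)
case: p => [|[|k]] // _ pf ph cf ch bf bh rf rh lf lh.
have [tf tf0 hf] := prox_Ck k pf cf bf rf lf.
have [th th0 hh] := prox_Ck k ph ch bh rh lh.
exists (Num.min tf th); first by rewrite lt_min tf0.
move=> t; rewrite lt_min => /and3P[t0 ttf tth] cond.
have [||_ [Of [oOf Ofx Cf]]] := hf t; first by rewrite t0.
  case: cond => [[r1 _ [M [s1 s2 s3]] _]|[[a1 a2] _ [a3 a4] _]]; [left|right].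
    by split=> //; exists M.
  by split.
have [||px [Oh [oOh Ohx Ch]]] := hh t; first by rewrite t0.
  case: cond => [[_ r1 _ [M [s1 s2 s3]]]|[_ [a1 a2] _ [a3 a4]]]; [left|right].
    by split=> //; exists M.
  by split.
apply: (setmap_Ck_on_FDRS oOf oOh _ Ohx px Cf Ch).
(* For [f] the subgradient is [- w], so its base point is the reflected point [xs - t *: w]. *)
by rewrite scalerN in Ofx.
Qed.
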